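(* Let $T>0$, let $W$ be a standard Brownian motion on $[0,T]$, and let $X(t)=\int_0^T K_{\mathfrak X}(t,s)\,dW(s)$, $t\in[0,T]$, be the Gaussian process with kernel $K_{\mathfrak X}$. Assume that $X$ is non-anticipating, i.e. adapted to the filtration $\{\mathcal{F}^W_t,\ 0\le t\le T\}$ generated by $W$ (so that $K_{\mathfrak X}(t,s)=0$ for $s>t$). (a) If $s_0<s_1<\dots<s_N$ are points in $[0,T]$ and $f(s)=\sum_{k=0}^{N-1}a_k(\chi_{s_{k+1}}(s)-\chi_{s_k}(s))$ is a step function, then $$\mathcal{K}^*f(s)=\sum_{i=0}^{N-1}\big(\chi_{s_{i+1}}(s)-\chi_{s_i}(s)\big)\Big(a_iK_{\mathfrak X}(s_{i+1},s)+\sum_{k=i+1}^{N-1}a_k\big(K_{\mathfrak X}(s_{k+1},s)-K_{\mathfrak X}(s_k,s)\big)\Big).$$ (b) If the function $K_{\mathfrak X}(\cdot,s)$ has bounded variation for every $s$ and $K_{\mathfrak X}(s^+,s)=\lim_{\delta\to0,\,\delta>0}K_{\mathfrak X}(s+\delta,s)$ exists for all $s\in(0,T)$, then $$\mathcal{K}^*f(s)=K_{\mathfrak X}(s^+,s)f(s)+\int_s^T f(t)\,K_{\mathfrak X}(dt,s)$$ for every function $f$ continuous on $[0,T]$. (c) Suppose the function $K_{\mathfrak X}(t,s)$ has the following properties: 1. $K_{\mathfrak X}$ is continuous and non-negative for $0\le s\le t\le T$, and $\sup_{0<t<T}K_{\mathfrak X}(t,t)\le K_0$; 2. for every fixed $s_0$,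 the function $K_{\mathfrak X}(t,s_0)$ is monotone as a function of $t$, and the partial derivative $K^{(1)}(t,s)=\partial K_{\mathfrak X}(t,s)/\partial t$ exists for all $0<s<t<T$; 3. there exists a number $K_1=K_1(T)$ such that $$\sup_{0<t<T}\int_0^t K_{\mathfrak X}(T,s)\,|K^{(1)}(t,s)|\,ds\le K_1^2.$$ Then the operator $\mathcal{K}^*$ defined by $$\mathcal{K}^*f(s)=K_{\mathfrak X}(s^+,s)f(s)+\int_s^Tf(t)\,K_{\mathfrak X}(dt,s)$$ is bounded on $L_2((0,T))$ and its operator norm satisfies $$\|\mathcal{K}^*\|^2\le (K_0+K_1)^2.$$
   Context: $\chi_t$ denotes the indicator function of $[0,t]$, so $\chi_{t_2}-\chi_{t_1}$ is the indicator of $(t_1,t_2]$ for $t_1<t_2$. The operator $\mathcal{K}^*$ corresponding to the kernel $K_{\mathfrak X}$ is determined by the requirement $(\mathcal{K}^*\chi_t)(s)=K_{\mathfrak X}(t,s)$: by linearity, on step functions $f(s)=\sum_{k=0}^{N-1}a_k(\chi_{s_{k+1}}(s)-\chi_{s_k}(s))$ it is given by $$\mathcal{K}^*f(s)=\sum_{k=0}^{N-1}a_k\big(K_{\mathfrak X}(s_{k+1},s)-K_{\mathfrak X}(s_k,s)\big),$$ and it is extended to continuous functions $f$ on $[0,T]$ by passing to the limit $\max_j|s_{j+1}-s_j|\to0$ along step functions $\sum_k f(s_k^* )(\chi_{s_{k+1}}-\chi_{s_k})$, $s_k^*\in[s_k,s_{k+1}]$, over partitions $0=s_0<\dots<s_N=T$.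 $K_{\mathfrak X}(dt,s)$ denotes the Stieltjes measure generated by the bounded variation function $t\mapsto K_{\mathfrak X}(t,s)$; $\int_s^T$ is the integral over $(s,T]$, with the jump at $t=s$ accounted for by the term $K_{\mathfrak X}(s^+,s)f(s)$. Boundedness in (c) means that the operator given by the stated formula on continuous (e.g. smooth compactly supported) functions extends to a bounded operator on $L_2((0,T))$.
   Formalization: Part (a) is stated for s in (s_0,T] only, since for s≤s_0 the right side vanishes while K*f(s) need not (e.g. K(t,s)=(t-s)^+); in (c) K_1≥0 is assumed, since K_1 enters the hypothesis only through K_1^2 and the bound fails for e.g. K_1=-K_0. *)

(* Defs.v *)
From HB Require Import structures.
From mathcomp Require Export all_boot all_order all_algebra.
From mathcomp Require Export all_classical all_reals all_analysis.

Set Implicit Arguments.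
Unset Strict Implicit.
Unset Printing Implicit Defensive.

Import Order.TTheory GRing.Theory Num.Theory.
Import numFieldNormedType.Exports.

Local Open Scope classical_set_scope.
Local Open Scope ring_scope.

(* Points t 0 < ... < t N of [0, T]; only the values at 0, ..., N matter. *)
Definition subdivision (R : realType) (T : R) (N : nat) (t : nat -> R) :=
  (forall k, (k <= N)%N -> t k \in `[0, T]) /\
  (forall k, (k < N)%N -> t k < t k.+1).

Definition chi (R : realType) (t : R) : R -> R := \1_`[0, t].

Definition step_fun (R : realType) (N : nat) (t a : nat -> R) : R -> R :=
  fun s => \sum_(k < N) a k * (chi (t k.+1) s - chi (t k) s).

Section BrownianMotion.
Context (R : realType) (d : measure_display) (Omega : measurableType d).
Variables (P : probability Omega R) (T : R).

(* The normal law is parametrised by its standard deviation. *)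
Record brownian_motion (W : R -> {RV P >-> R}) : Prop := {
  bm_start : {ae P, forall w, W 0 w = 0};
  bm_gauss : forall u v, 0 <= u -> u < v -> v <= T ->
    forall A : set R, measurable A ->
    P [set w | A (W v w - W u w)] = normal_prob 0 (Num.sqrt (v - u)) A;
  bm_indep : forall (n : nat) (t : nat -> R), subdivision T n t ->
    forall B : nat -> set R, (forall i, measurable (B i)) ->
    P (\bigcap_(i < n) [set w | B i (W (t i.+1) w - W (t i) w)]) =
    (\prod_(i < n) P [set w | B i (W (t i.+1) w - W (t i) w)%R])%E;
  bm_path : {ae P, forall w, {within `[0, T], continuous (fun t => W t w)}}
}.

(* The null sets are included because a stochastic integral is only defined
   up to almost sure equality. *)
Definition brownian_filtration (W : R -> {RV P >-> R}) (t : R) :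
    set (set Omega) :=
  <<s [set A | (exists r B, [/\ r \in `[0, t], measurable B &
                               A = W r @^-1` (B : set R)])
               \/ (measurable A /\ P A = 0%E)] >>.

Definition adapted (W X : R -> {RV P >-> R}) :=
  forall t, t \in `[0, T] -> forall B : set R, measurable B ->
    brownian_filtration W t (X t @^-1` B).

Definition step_wiener (W : R -> {RV P >-> R}) (N : nat) (t a : nat -> R) :
    Omega -> R :=
  fun w => \sum_(k < N) a k * (W (t k.+1) w - W (t k) w).

(* Y is the integral of g over [0, T] with respect to W: the L^2(P) limit of
   the elementary integrals of step functions converging to g in
   L^2([0, T]). *)
Definition is_wiener_integral (W : R -> {RV P >-> R}) (g : R -> R)
    (Y : Omega -> R) :=
  [/\ measurable_fun `[0, T] g,
      (\int[lebesgue_measure]_(s in `[0%R, T]) ((g s) ^+ 2)%:E < +oo)%E &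
      exists (N : nat -> nat) (t a : nat -> nat -> R),
      [/\ forall n, subdivision T (N n) (t n),
          (\int[lebesgue_measure]_(s in `[0%R, T])
             ((g s - step_fun (N n) (t n) (a n) s) ^+ 2)%:E)%E
            @[n --> \oo] --> 0%E &
          (\int[P]_w ((Y w - step_wiener W (N n) (t n) (a n) w) ^+ 2)%:E)%E
            @[n --> \oo] --> 0%E]].

End BrownianMotion.

Section KernelOperator.
Context (R : realType).
Variables (T : R) (K : R -> R -> R).

Definition chi_span : set (R -> R) :=
  [set f | exists (n : nat) (c t : nat -> R),
     (forall i, (i < n)%N -> t i \in `[0, T]) /\
     f = (fun s => \sum_(i < n) c i * chi (t i) s)].

(* l is the limit of Op g s over the step functions
   g = \sum_k f (tau_k) (chi (p_(k+1)) - chi (p_k)) attached to the tagged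
   partitions 0 = p_0 < ... < p_N = T whose mesh tends to 0. *)
Definition tagged_limit (Op : (R -> R) -> R -> R) (f : R -> R) (s l : R) :=
  forall e, 0 < e -> exists2 delta, 0 < delta &
    forall (N : nat) (p tau : nat -> R),
      subdivision T N p -> p 0%N = 0 -> p N = T ->
      (forall k, (k < N)%N -> p k.+1 - p k < delta) ->
      (forall k, (k < N)%N -> tau k \in `[p k, p k.+1]) ->
      `|Op (step_fun N p (fun k => f (tau k))) s - l| < e.

(* The last field is restricted to the open interval: for f = 1 on [0, T] it
   gives K T s - K 0 s, which agrees with the first field (applied to chi T)
   when K 0 s = 0, hence for 0 < s if K vanishes above the diagonal. *)
Record kernel_operator (Op : (R -> R) -> R -> R) : Prop := {
  kernel_operator_chi : forall t s, t \in `[0, T] -> s \in `[0, T] ->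
    Op (chi t) s = K t s;
  kernel_operator_linear : forall (a : R) (f g : R -> R),
    chi_span f -> chi_span g -> forall s, s \in `[0, T] ->
    Op (fun x => a * f x + g x) s = a * Op f s + Op g s;
  kernel_operator_limit : forall f : R -> R,
    {within `[0, T], continuous f} -> forall s l, s \in `]0, T[ ->
    tagged_limit Op f s l -> Op f s = l
}.

End KernelOperator.

Section StieltjesIntegral.
Context (R : realType).

Definition clamp (a b t : R) : R := Num.max a (Num.min t b).

(* The Stieltjes measure of g on ]a, b] gives mass g(v+) - g(u+) to ]u, v]
   (with g(b+) replaced by g(b)), so it is generated by the right-continuous
   modification of g. *)
Definition rc_modification (a b : R) (g : R -> R) (t : R) : R :=
  let u := clamp a b t in if u < b then lim (g x @[x --> u^'+]) else g b.

Definition pos_part_bv (a b : R) (g : R -> R) (t : R) : R :=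
  fine (pos_tv a (rc_modification a b g) (clamp a b t)).

Definition neg_part_bv (a b : R) (g : R -> R) (t : R) : R :=
  fine (neg_tv a (rc_modification a b g) (clamp a b t)).

Definition is_cumulative (h : R -> R) :=
  {homo h : x y / x <= y} /\ (forall x, h y @[y --> x^'+] --> h x).

Definition cumulative_pack (h : R -> R) (hh : is_cumulative h) :
    cumulative R R :=
  HB.pack_for (cumulative R R) h
    (isCumulative.Build R _ R h hh.1 hh.2).

Lemma is_cumulative0 : is_cumulative (fun _ => 0 : R).
Proof. by split=> // x; exact: cvg_cst. Qed.

(* The value on functions that are not cumulative is irrelevant. *)
Definition to_cumulative (h : R -> R) : cumulative R R :=
  match pselect (is_cumulative h) with
  | left hh => cumulative_pack hh
  | right _ => cumulative_pack is_cumulative0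
  end.

(* Integral of f over ]a, b] with respect to the signed measure generated by
   the function g, of bounded variation on [a, b]. *)
Definition stieltjes_integral (a b : R) (g f : R -> R) : R :=
  \int[lebesgue_stieltjes_measure (to_cumulative (pos_part_bv a b g))]_(t in
    `]a, b]) f t -
  \int[lebesgue_stieltjes_measure (to_cumulative (neg_part_bv a b g))]_(t in
    `]a, b]) f t.

End StieltjesIntegral.

Definition diag_right (R : realType) (K : R -> R -> R) (s : R) : R :=
  lim (K t s @[t --> s^'+]).

Definition kstar_formula (R : realType) (T : R) (K : R -> R -> R)
    (f : R -> R) (s : R) : R :=
  diag_right K s * f s + stieltjes_integral s T (K^~ s) f.

Section L2Operator.
Context (R : realType).
Variable (T : R).

Definition lebesgue_on : {measure set (measurableTypeR R) -> \bar R} :=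
  mrestr (@lebesgue_measure R) (measurable_itv `]0, T[).

Definition L2 : Type := LfunType lebesgue_on (lee1n 2).

Definition L2norm (f : L2) : \bar R := 'N[lebesgue_on]_2%:E[EFin \o f].

(* Elements of L2 are functions, not classes: operators have to be compatible
   with equality almost everywhere, and are linear only up to it. *)
Record L2_operator (A : L2 -> L2) : Prop := {
  L2_operator_ae : forall f g : L2,
    {ae lebesgue_on, forall s, f s = g s} ->
    {ae lebesgue_on, forall s, A f s = A g s};
  L2_operator_linear : forall (a : R) (f g : L2),
    {ae lebesgue_on, forall s, A (a *: f + g) s = a * A f s + A g s}
}.

Definition L2_opnorm (A : L2 -> L2) : \bar R :=
  ereal_sup [set L2norm (A f) | f in [set f : L2 | (L2norm f <= 1)%E]].

Definition L2_bounded (A : L2 -> L2) :=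
  L2_operator A /\ (L2_opnorm A < +oo)%E.

Definition L2_extends (Op : (R -> R) -> R -> R) (A : L2 -> L2) :=
  forall f : R -> R, {within `[0, T], continuous f} ->
  forall g : L2, (forall s, s \in `]0, T[ -> g s = f s) ->
  {ae lebesgue_on, forall s, A g s = Op f s}.

End L2Operator.

(* Main.v *)
(* (a) is linearity together with [K t s = 0] for [t < s].

   (b) Write [g = K(., s)] and let [h] be its right-continuous modification on
   [[s, T]]. The Stieltjes sums of [g] split into those of [h], which converge
   to the integral against the measure generated by [h], those of the jump
   [K(s+, s)] of [g] at [s], and those of [g - h]. The last ones vanish in the
   limit because the sum of the values of [|g - h|] over any partition is
   bounded by the variation of [g].

   (c) For [0 < s] the function [K(., s)] is nondecreasing, continuous on
   [[s, T]] and differentiable everywhere inside; a covering argument then shows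
   that its Stieltjes measure has density [K^(1)(., s)]. By Cauchy-Schwarz,
   [(\int_s^T |f| K^(1)(t, s) dt)^2 <= K(T, s) \int_s^T f^2 K^(1)(t, s) dt], and
   integrating in [s] with Tonelli's theorem gives at most [K1^2 ||f||^2]. *)

Require Import Defs.
From mathcomp Require Import ring lra measurable_realfun.

Set Implicit Arguments.
Unset Strict Implicit.
Unset Printing Implicit Defensive.

Import Order.TTheory GRing.Theory Num.Theory.
Import numFieldNormedType.Exports.

Local Open Scope classical_set_scope.
Local Open Scope ring_scope.

(** * Comparison of Stieltjes measures *)

(** The derivative in (c) exists at every interior point but need not be continuous, so the
    classical fundamental theorem of calculus does not apply. A comparison replaces it: if around
    every point of a set the increments of [F] are at most [c] times those of [G], the same holds
    for the measures of the set. With the identity as one of the two functions, slicing by the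
    values of the derivative gives the density.

    The formula in (c) is phrased with the positive and negative variations of a right-continuous
    modification. These are never computed: (b) exhibits the formula as a limit of Stieltjes sums,
    the density operator is a limit of the same sums, and such limits are unique.

    For an element of [L2] the integral against the kernel may diverge at some [s]. The operator is
    therefore defined everywhere with a default value, and linearity is proved where the integral of
    the absolute value is finite, which the norm estimate shows to be almost everywhere. The
    constant [K0 + K1] comes from the triangle inequality: multiplication by the diagonal has norm
    at most [K0], the integral part at most [K1]. *)

Section StieltjesComparison.
Context {R : realType}.
Implicit Types (F G : cumulative R R) (D E : set R) (a b c q r : R).

Lemma stieltjes_itv_oc F a b : a <= b ->
  lebesgue_stieltjes_measure F `]a, b]%classic = (F b - F a)%:E.
Proof.
move=> ab; rewrite /lebesgue_stieltjes_measure /measure_extension.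
by rewrite measurable_mu_extE/=; [rewrite wlength_itv_bnd|exact: is_ocitv].
Qed.

(* Every interval of a cover of [D] that meets [D] may be cut down to [`]q, r]],
   where the increments of [F] and [G] are compared. *)
Lemma stieltjes_le_local F G D q r c : 0 < c -> D `<=` `]q, r] ->
  (forall a b x, D x -> q <= a -> a < x -> x <= b -> b <= r ->
    F b - F a <= c * (G b - G a)) ->
  (lebesgue_stieltjes_measure F D <= c%:E * lebesgue_stieltjes_measure G D)%E.
Proof.
move=> c0 Dqr FG.
(* Both sides are infima over countable covers. Moving [c] to the left leaves one task: turn each
   cover used for [G] into a cover for [F] whose length is at most [c] times as large. *)
rewrite -lee_pdivrMl//; apply: le_ereal_inf_tmp => _ [A [mA DA] <-].
rewrite lee_pdivrMl// -nneseriesZl; last by move=> *; exact: wlength_ge0.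
pose B k := if `[< exists x, D x /\ A k x >] then A k `&` `]q, r]%classic else set0.
have mB k : measurable (B k : set (ocitv_type R)).
  rewrite /B; case: ifPn => _; last exact: measurable0.
  by apply: measurableI => //; exact: is_ocitv.
have DB : D `<=` \bigcup_k B k.
  move=> x Dx; have [k _ Akx] := DA x Dx; exists k => //.
  rewrite /B ifT; first by split => //; exact: Dqr.
  by apply/asboolP; exists x.
apply: (@le_trans _ _ (\sum_(k <oo) wlength F (B k))%E).
  by apply: ereal_inf_lbound; exists B.
apply: lee_nneseries => k _; first by move=> _; exact: wlength_ge0.
rewrite /B; case: ifPn => [/asboolP[x [Dx Akx]]|_]; last first.
  by rewrite wlength0 mule_ge0 ?wlength_ge0// lee_fin ltW.
have [A0|[[a b]/= ab AE]] := (ocitvP (A k)).1 (mA k).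
  by move: Akx; rewrite A0.
have xqr := Dqr _ Dx.
have -> : A k `&` `]q, r]%classic = `]Num.max a q, Num.min b r]%classic.
  rewrite AE; apply/seteqP; split => y /=; rewrite !in_itv/= gt_max le_min.
    by move=> [/andP[-> ->] /andP[-> ->]].
  by move=> /andP[/andP[-> ->] /andP[-> ->]].
move: Akx xqr; rewrite AE/= !in_itv/= => /andP[ax xb] /andP[qx xr].
rewrite !wlength_itv_bnd ?(ltW ab)//; last first.
  by rewrite ge_max !le_min !(ltW (lt_le_trans _ xb)) ?(ltW (lt_le_trans _ xr)).
rewrite -EFinM lee_fin; apply: (@le_trans _ _
    (c * (G (Num.min b r) - G (Num.max a q)))).
  by apply: (FG _ _ x) => //; rewrite ?le_max ?gt_max ?le_min ?ge_min ?ax ?qx ?xb ?xr ?lexx ?orbT.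
rewrite ler_pM2l// lerB//; apply: cumulative_is_nondecreasing.
  by rewrite ge_min lexx.
by rewrite le_max lexx.
Qed.

(** Only intervals with [a < x <= b] are tested because the measures are built from covers by
    intervals []a, b]]. Comparing covers directly avoids a Vitali selection. *)
Lemma stieltjes_le_deriv F G E c : 0 < c -> measurable E ->
  (forall x, E x -> exists2 delta, 0 < delta &
    forall a b, x - delta < a -> a < x -> x <= b -> b < x + delta ->
    F b - F a <= c * (G b - G a)) ->
  (lebesgue_stieltjes_measure F E <= c%:E * lebesgue_stieltjes_measure G E)%E.
Proof.
move=> c0 mE FG.
(* [E] is a countable union of small pieces on each of which the local bound
   holds uniformly; [good q m] is measurable because its complement is open, by
   right continuity of [G]. *)
pose h (m : nat) : R := m.+1%:R^-1.
have h0 m : 0 < h m by rewrite invr_gt0.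
pose good (q : R) m := [set x | forall a b, q <= a -> a < x -> x <= b ->
  b < q + 2 * h m -> F b - F a <= c * (G b - G a)].
have mgood q m : measurable (good q m).
  rewrite -[good q m]setCK; apply: measurableC; apply: open_measurable.
  rewrite openE => x /= /existsNP[a /existsNP[b]].
  move=> /not_implyP[qa] /not_implyP[ax] /not_implyP[xb] /not_implyP[bq].
  move=> /negP; rewrite -ltNge => bad.
  pose e := ((F b - F a) - c * (G b - G a)) / 2.
  have e0 : 0 < e by rewrite divr_gt0// subr_gt0.
  (* The bad interval may end at [x] itself, so [b] is pushed to some [b' > b] in order to stay bad
     for points just to the right of [x]. Half of the gap, [e], pays for the growth of [G]. *)
  have [dl dlE] := nondecreasing_right_continuousP b G (divr_gt0 e0 c0).
  pose b' := Num.min (b + dl%:num) ((b + (q + 2 * h m)) / 2).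
  have bb' : b < b'.
    by rewrite lt_min ltrDl gt0 /= midf_lt.
  have b'q : b' < q + 2 * h m by rewrite gt_min midf_lt// orbT.
  exists (Num.min (x - a) (b' - x)) => /=.
    by rewrite lt_min !subr_gt0 ax (le_lt_trans xb bb').
  move=> y /=; rewrite lt_min => /andP[xya xyb] /(_ a b' qa).
  have ay : a < y.
    by move: xya; rewrite -[x - y]opprB normrN ltr_norml opprB => /andP[+ _]; rewrite ltrBrDl subrKC.
  have yb' : y <= b'.
    by rewrite -subr_ge0; move: xyb; rewrite -[x - y]opprB normrN ltr_norml => /andP[_]; rewrite ltrBlDr subrK => /ltW; rewrite subr_ge0.
  move=> /(_ ay yb' b'q); apply/negP; rewrite -ltNge.
  have Gb' : c * (G b' - G a) <= c * (G b - G a) + e.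
    rewrite -[e](mulVKf (lt0r_neq0 c0)) -mulrDr ler_pM2l// addrAC lerD2r mulrC.
    apply: le_trans dlE; apply: cumulative_is_nondecreasing.
    by rewrite ge_min lexx.
  have Fb' : F b <= F b' by apply: cumulative_is_nondecreasing; exact: ltW.
  rewrite /e in Gb'; move: (c * (G b - G a)) (c * (G b' - G a)) bad Gb' => u v.
  by lra.
(* Rational left ends keep the pieces countable in number. A piece has length [h m], while [good]
   tolerates right ends below [q + 2 * h m]; the slack admits intervals that end exactly at
   [q + h m]. *)
pose A n := if @unpickle (rat * nat)%type n is Some (q, m) then
  E `&` (`]ratr q, ratr q + h m]%classic `&` good (ratr q) m) else set0.
have mA n : measurable (A n).
  rewrite /A; case: unpickle => [[q m]|]; last exact: measurable0.
  by apply: measurableI => //; exact: measurableI.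
have EA : E = \bigcup_n A n.
  apply/seteqP; split => [x Ex|x [n _]]; last first.
    by rewrite /A; case: unpickle => [[q m] []|].
  have [dl dl0 xdl] := FG _ Ex.
  have [m mdl] : exists m, 2 * h m < dl.
    have dl2 : 0 < dl / 2 by rewrite divr_gt0.
    have [m] := ltr_add_invr dl2; rewrite add0r => hm; exists m.
    by rewrite mulrC -ltr_pdivlMr.
  have [q] : exists q : rat, ratr q \in `]x - h m, x[.
    by apply: rat_in_itvoo; rewrite ltrBlDr ltrDl.
  rewrite in_itv/= => /andP[xq qx]; exists (pickle (q, m)); first exact: I.
  rewrite /A pickleK; split; first exact: Ex.
  split.
    by rewrite /= in_itv/= qx/= ltW// -ltrBlDr.
  have hm0 := h0 m.
  move=> a b qa ax xb bq; apply: xdl => //; lra.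
rewrite EA seqDU_bigcup_eq.
have mD n : measurable (seqDU A n).
  rewrite /seqDU; apply: measurableD => //.
  by apply: bigsetU_measurable.
rewrite !measure_bigcup//; 
  try exact: trivIset_seqDU; try (by move=> i _; exact: mD).
rewrite -nneseriesZl//; apply: lee_nneseries => // n _.
have := @subset_seqDU _ A n; rewrite {2}/A.
case: unpickle => [[q m]|]; last first.
  by rewrite subset0 => ->; rewrite !measure0 mule0.
move=> DE; apply: (@stieltjes_le_local _ _ _ (ratr q) (ratr q + h m)) => //.
  by move=> x /DE [_ []].
move=> a b x /DE[_ [_ xg]] qa ax xb bq; apply: xg => //.
by rewrite (le_lt_trans bq)// ltrD2l ltr_pMl// ltr1n.
Qed.

End StieltjesComparison.

(** * Density of a Stieltjes measure *)

Section StieltjesDensity.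
Context {R : realType}.

(** The interval straddles [x], so its increment splits at [x], and the two errors [e * (x - a)] and
    [e * (b - x)] add up to [e * (b - a)]. *)
Lemma derive_slope_bounds (f : R -> R) (x l e : R) : is_derive x 1 f l -> 0 < e ->
  exists2 delta, 0 < delta & forall a b, x - delta < a -> a < x -> x <= b ->
  b < x + delta -> (l - e) * (b - a) <= f b - f a <= (l + e) * (b - a).
Proof.
move=> [df <-] e0; move: df => /cvgrPdist_le /(_ _ e0)[dl/= dl0 fdl].
exists dl => // a b xa ax xb bx.
have slope y : y != x -> `|y - x| < dl -> `|'D_1 f x * (y - x) - (f y - f x)| <= e * `|y - x|.
  move=> yx ydl; have yx0 : y - x != 0 by rewrite subr_eq0.
  have := fdl (y - x); rewrite /= sub0r normrN ydl => /(_ erefl yx0).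
  rewrite -[_%:A]/(_ * _) mulr1 subrK -[_ *: _]/(_ * _) => dle.
  rewrite -ler_pdivrMr ?normr_gt0// -normfV -normrM mulrBl mulfK//.
  by rewrite [_ * (y - x)^-1]mulrC.
have := slope a (negbT (lt_eqF ax)).
rewrite (ltr0_norm (_ : a - x < 0)) ?subr_lt0// opprB ltrBlDr -ltrBlDl => /(_ xa) sa.

have sb : `|'D_1 f x * (b - x) - (f b - f x)| <= e * (b - x).
  move: xb; rewrite le_eqVlt => /predU1P[->|xb].
    by rewrite !subrr mulr0 subr0 normr0 mulr0.
  have := slope b (negbT (gt_eqF xb)).
  by rewrite (gtr0_norm (_ : 0 < b - x)) ?subr_gt0// ltrBlDl => /(_ bx).
move: sa sb; rewrite !ler_norml; lra.
Qed.


Local Notation lambda := (@lebesgue_measure R).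

Lemma stieltjes_density (F : cumulative R R) (E : set R) (h : R -> R) :
  measurable E -> (lambda E < +oo)%E -> measurable_fun E h ->
  (forall x, E x -> 0 <= h x) -> (forall x, E x -> is_derive x 1 F (h x)) ->
  lebesgue_stieltjes_measure F E = (\int[lambda]_(x in E) (h x)%:E)%E.
Proof.
move=> mE Eoo mh h0 Fh.
(* The errors are multiples of [lambda E], which is finite, so they vanish with [e]. *)
suff near_eq e : 0 < e ->
    (lebesgue_stieltjes_measure F E <=
       \int[lambda]_(x in E) (h x)%:E + e%:E * lambda E /\
     \int[lambda]_(x in E) (h x)%:E <=
       lebesgue_stieltjes_measure F E + (2 * e)%:E * lambda E)%E.
  have lE : lambda E = (fine (lambda E))%:E by rewrite fineK// ge0_fin_numE.
  have lE0 : 0 <= fine (lambda E) by rewrite fine_ge0.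
  apply/eqP; rewrite eq_le; apply/andP; split; apply/lee_addgt0Pr => e e0.
    have d0 : 0 < e / (fine (lambda E) + 1) by rewrite divr_gt0// ltr_wpDl.
    apply: (le_trans (near_eq _ d0).1); rewrite leeD2l// lE -EFinM lee_fin.
    by rewrite mulrAC ler_pdivrMr ?ltr_wpDl// ler_pM2l// lerDl.
  have d0 : 0 < e / (2 * (fine (lambda E) + 1)).
    by rewrite divr_gt0// mulr_gt0// ltr_wpDl.
  apply: (le_trans (near_eq _ d0).2); rewrite leeD2l// lE -EFinM lee_fin.
  rewrite invfM [e * _]mulrCA [2 * (_ * _)]mulrA divff// mul1r.
  by rewrite mulrAC ler_pdivrMr ?ltr_wpDl// ler_pM2l// lerDl.
move=> e0.
(* On a slice [h] varies by less than [e], and the Stieltjes measure is compared with Lebesgue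
   measure, which is the Stieltjes measure of the identity. *)
pose A n := E `&` h @^-1` `[n%:R * e, n.+1%:R * e[%classic.
have mA n : measurable (A n) by exact: mh.
have tA : trivIset setT A.
  apply/trivIsetP => m n _ _ mn; apply/seteqP; split => // x.
  move=> [[_ /=]]; rewrite in_itv/= => /andP[m1 m2] [_ /=].
  rewrite in_itv/= => /andP[n1 n2]; move: mn; apply/negP; rewrite negbK.
  have := le_lt_trans m1 n2; have := le_lt_trans n1 m2.
  by rewrite !ltr_pM2r// !ltr_nat !ltnS => nm mn; rewrite eqn_leq mn.
have EA : E = \bigcup_n A n.
  apply/seteqP; split => [x Ex|x [n _ []//]].
  have he0 : 0 <= h x / e by rewrite divr_ge0 ?h0// ltW.
  exists (Num.truncn (h x / e)) => //; split => //=.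
  rewrite in_itv/=; have /andP[] := truncn_itv he0.
  by rewrite ler_pdivlMr// ltr_pdivrMr// => -> ->.
have mhA n : measurable_fun (A n) h.
  by apply: measurable_funS mh => // x [].
have mhE n : measurable_fun (A n) (EFin \o h) by exact/measurable_EFinP.
have hA0 n x : A n x -> 0 <= h x by move=> [/h0].
have leF n : (lebesgue_stieltjes_measure F (A n) <= (n.+1%:R * e)%:E * lambda (A n))%E.
  apply: stieltjes_le_deriv => //; first by rewrite mulr_gt0.
  move=> x [Ex /=]; rewrite in_itv/= => /andP[_ hx].
  have d0 : 0 < n.+1%:R * e - h x by rewrite subr_gt0.
  have [dl dl0 xdl] := derive_slope_bounds (Fh x Ex) d0.
  exists dl => // a b xa ax xb bx.
  by have /andP[_] := xdl a b xa ax xb bx; rewrite subrKC.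
(* The slope used as a lower bound must be strictly below [h], so slice [n.+1] is compared with
   [n%:R * e]. The lost level accounts for the [2 * e] in the second estimate. *)
have geF n : ((n%:R * e)%:E * lambda (A n.+1) <= lebesgue_stieltjes_measure F (A n.+1))%E.
  case: n => [|n]; first by rewrite mul0r mul0e.
  have ne0 : 0 < n.+1%:R * e by rewrite mulr_gt0.
  rewrite -lee_pdivlMl//; apply: stieltjes_le_deriv => //.
    by rewrite invr_gt0.
  move=> x [Ex /=]; rewrite in_itv/= => /andP[hx _].
  have d0 : 0 < h x - n.+1%:R * e.
    by rewrite subr_gt0 (lt_le_trans _ hx)// ltr_pM2r// ltr_nat.
  have [dl dl0 xdl] := derive_slope_bounds (Fh x Ex) d0.
  exists dl => // a b xa ax xb bx.
  have /andP[+ _] := xdl a b xa ax xb bx.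
  by rewrite opprB subrKC ler_pdivlMl.
have leI n : (\int[lambda]_(x in A n) (h x)%:E <= (n.+1%:R * e)%:E * lambda (A n))%E.
  rewrite -(integral_cst lambda (mA n)); apply: ge0_le_integral => //; first exact: mA.
  - by move=> x Ax; rewrite lee_fin (hA0 n).
  - exact: mhE.
  - by move=> x [_ /=]; rewrite in_itv/= => /andP[_ /ltW].
have geI n : ((n%:R * e)%:E * lambda (A n) <= \int[lambda]_(x in A n) (h x)%:E)%E.
  rewrite -(integral_cst lambda (mA n)); apply: ge0_le_integral => //; first exact: mA.
  - by move=> x _; rewrite lee_fin mulr_ge0// ltW.
  - exact: mhE.
  - by move=> x [_ /=]; rewrite in_itv/= => /andP[].
have up n : (lebesgue_stieltjes_measure F (A n) <=
    \int[lambda]_(x in A n) (h x)%:E + e%:E * lambda (A n))%E.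
  apply: (le_trans (leF n)); rewrite -natr1 mulrDl mul1r EFinD ge0_muleDl ?lee_fin//.
  - by rewrite leeD2r// geI.
  - by rewrite mulr_ge0// ltW.
  - exact: ltW.
have lo n : (\int[lambda]_(x in A n) (h x)%:E <=
    lebesgue_stieltjes_measure F (A n) + (2 * e)%:E * lambda (A n))%E.
  case: n => [|n].
    apply: (le_trans (leI 0%N)); rewrite (@le_trans _ _ ((2 * e)%:E * lambda (A 0%N))%E)//.
      by rewrite lee_wpmul2r// lee_fin ler_pM2r// ler1n.
    by rewrite leeDr.
  apply: (le_trans (leI n.+1)); rewrite -addn2 natrD mulrDl EFinD ge0_muleDl ?lee_fin//.
  - by rewrite leeD2r// geF.
  - by rewrite mulr_ge0// ltW.
  - by rewrite mulr_ge0// ltW.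
have sumE (m : {measure set (measurableTypeR R) -> \bar R}) :
    m E = (\sum_(n <oo) m (A n))%E.
  rewrite EA measure_bigcup//; last by move=> i _; exact: mA.
  by apply: eq_eseriesl => i; rewrite in_setT.
have -> : (\int[lambda]_(x in E) (h x)%:E =
    \sum_(n <oo) \int[lambda]_(x in A n) (h x)%:E)%E.
  rewrite EA ge0_integral_bigcup//.
  - by rewrite -EA; exact/measurable_EFinP.
  - by rewrite -EA => x Ex; rewrite lee_fin h0.
have I0 n : (0 <= \int[lambda]_(x in A n) (h x)%:E)%E.
  by apply: integral_ge0 => x Ax; rewrite lee_fin (hA0 n).
rewrite !sumE; split.
  rewrite -nneseriesZl// -nneseriesD//.
    by apply: lee_nneseries => // n _; exact: up.
  by move=> n _; rewrite mule_ge0// lee_fin ltW.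
rewrite -nneseriesZl// -nneseriesD//.
  by apply: lee_nneseries => // n _; exact: lo.
by move=> n _; rewrite mule_ge0// lee_fin mulr_ge0// ltW.
Qed.

End StieltjesDensity.

(** * Limits of Stieltjes sums *)

Section RiemannStieltjes.
Context {R : realType}.
Implicit Types (T a b s e : R) (f g G I : R -> R).

(** Heine-Cantor, with compactness in its near-covering form: what holds for all small [d] near each
    point of the segment holds for all small [d] on the whole segment at once. *)
Lemma within_continuous_uniform a b f e : {within `[a, b], continuous f} ->
  0 < e -> exists2 delta, 0 < delta & forall x y, x \in `[a, b] ->
  y \in `[a, b] -> `|x - y| < delta -> `|f x - f y| <= e.
Proof.
move=> /subspace_continuousP cf e0.
pose P (d x' : R) := x' \in `[a, b] -> forall y, y \in `[a, b] ->
  `|x' - y| < d -> `|f x' - f y| <= e.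
have := (@compact_near_coveringP _ _).1 (@segment_compact _ a b) _ (at_right (0 : R)) P.
move=> /(_ _)/(_ _)[|dl /= dl0 dlP]; last first.
  have d20 : 0 < dl / 2 by rewrite divr_gt0.
  exists (dl / 2) => // x y xab yab xy.
  apply: (dlP (dl / 2)) => //=.
  by rewrite sub0r normrN gtr0_norm// ltr_pdivrMr// ltr_pMr// ltr1n.
move=> x xab.
have e20 : 0 < e / 2 by rewrite divr_gt0.
have /cvgrPdist_le /(_ _ e20)[r /= r0 xr] := cf x xab.
have r20 : 0 < r / 2 by rewrite divr_gt0.
exists (ball x (r / 2), [set d | 0 < d < r / 2]) => /=.
  split; first exact: nbhsx_ballx.
  exists (r / 2) => // d /=; rewrite sub0r normrN => + d0.
  by rewrite gtr0_norm// => ->; rewrite d0.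
move=> [x' d] /= [xx' /andP[d0 dr]] x'ab y yab x'y.
rewrite -(subrKA (f x)) (le_trans (ler_normD _ _))// [leRHS]splitr lerD//.
  rewrite distrC; apply: xr => //=; first by apply: lt_trans xx' _; lra.
apply: xr => //=.
rewrite -(subrKA x') (le_lt_trans (ler_normD _ _))// [ltRHS]splitr ltrD//.
exact: lt_trans dr.
Qed.

Definition rs_sum f g (N : nat) (p tau : nat -> R) :=
  \sum_(k < N) f (tau k) * (g (p k.+1) - g (p k)).

Definition fine_partition T delta (N : nat) (p tau : nat -> R) :=
  [/\ subdivision T N p, p 0%N = 0, p N = T,
     (forall k, (k < N)%N -> p k.+1 - p k < delta) &
     (forall k, (k < N)%N -> tau k \in `[p k, p k.+1])].

(** This is [tagged_limit] with the values of the operator replaced by Stieltjes sums, so that the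
    analysis does not involve the operator. *)
Definition rs_limit T f g l := forall e, 0 < e -> exists2 delta, 0 < delta &
  forall N p tau, fine_partition T delta N p tau -> `|rs_sum f g N p tau - l| < e.

Lemma fine_partitionW T delta delta' N p tau : delta <= delta' ->
  fine_partition T delta N p tau -> fine_partition T delta' N p tau.
Proof.
move=> dd [? ? ? pd ?]; split => // k kN.
exact: lt_le_trans (pd k kN) dd.
Qed.

(** Keeps [rs_limit] from holding vacuously, which is what uniqueness of the limit rests on. The
    witness is the equidistant partition tagged at left ends. *)
Lemma fine_partition_ex T delta : 0 < T -> 0 < delta ->
  exists N p tau, fine_partition T delta N p tau.
Proof.
move=> T0 d0; have [n] := ltr_add_invr (divr_gt0 d0 T0).
rewrite add0r => hn.
have n0 : 0 < n.+1%:R :> R by [].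
pose p (k : nat) : R := T * (k%:R / n.+1%:R).
have pS k : p k.+1 - p k = T / n.+1%:R.
  by rewrite -mulrBr -mulrBl -natr1 addrAC subrr add0r mul1r.
exists n.+1, p, p; split => //.
- split => [k kn|k _]; last by rewrite -subr_gt0 pS divr_gt0.
  rewrite in_itv/= /p; apply/andP; split.
    by rewrite mulr_ge0 ?divr_ge0// ltW.
  rewrite ger_pMr//.
  by rewrite ler_pdivrMr// mul1r ler_nat.
- by rewrite /p mul0r mulr0.
- by rewrite /p divff ?mulr1// lt0r_neq0.
- by move=> k _; rewrite pS mulrC -ltr_pdivlMr.
- move=> k _; rewrite in_itv/= lexx -subr_ge0 pS.
  by rewrite divr_ge0// ltW.
Qed.

Lemma rs_limit_unique T f g l l' : 0 < T ->
  rs_limit T f g l -> rs_limit T f g l' -> l = l'.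
Proof.
move=> T0 gl gl'; apply/eqP; rewrite -subr_eq0 -normr_le0.
apply/ler_addgt0Pr => e e0; rewrite add0r.
have e20 : 0 < e / 2 by rewrite divr_gt0.
have [d d0 dP] := gl _ e20; have [d' d'0 d'P] := gl' _ e20.
have dd0 : 0 < Num.min d d' by rewrite lt_min d0.
have [N [p [tau pN]]] := fine_partition_ex T0 dd0.
have dd : Num.min d d' <= d by rewrite ge_min lexx.
have dd' : Num.min d d' <= d' by rewrite ge_min lexx orbT.
have := d'P _ _ _ (fine_partitionW dd' pN).
have := dP _ _ _ (fine_partitionW dd pN).
rewrite !ltr_norml ler_norml; lra.
Qed.

Lemma rs_sumD f g g' N p tau :
  rs_sum f (g \+ g') N p tau = rs_sum f g N p tau + rs_sum f g' N p tau.
Proof. by rewrite -big_split/=; apply: eq_bigr => i _ /=; ring. Qed.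

Lemma rs_sumN f g N p tau : rs_sum f (\- g) N p tau = - rs_sum f g N p tau.
Proof. by rewrite -sumrN; apply: eq_bigr => i _ /=; ring. Qed.

Lemma rs_limitD T f g g' l l' : rs_limit T f g l -> rs_limit T f g' l' ->
  rs_limit T f (g \+ g') (l + l').
Proof.
move=> gl gl' e e0.
have e20 : 0 < e / 2 by rewrite divr_gt0.
have [d d0 dP] := gl _ e20; have [d' d'0 d'P] := gl' _ e20.
exists (Num.min d d'); first by rewrite lt_min d0.
move=> N p tau pN.
have dd : Num.min d d' <= d by rewrite ge_min lexx.
have dd' : Num.min d d' <= d' by rewrite ge_min lexx orbT.
rewrite rs_sumD opprD addrACA (le_lt_trans (ler_normD _ _))//.
rewrite [ltRHS]splitr ltrD//; first exact: dP (fine_partitionW dd pN).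
exact: d'P (fine_partitionW dd' pN).
Qed.

Lemma rs_limitN T f g l : rs_limit T f g l -> rs_limit T f (\- g) (- l).
Proof.
move=> gl e e0; have [d d0 dP] := gl _ e0.
by exists d => // N p tau pN; rewrite rs_sumN -opprD normrN dP.
Qed.

Lemma subdivision_bounds T N p k : subdivision T N p -> (k <= N)%N ->
  0 <= p k <= T.
Proof. by move=> [pT _] /pT; rewrite in_itv. Qed.

Lemma subdivision_le T N p i j : subdivision T N p -> (i <= j <= N)%N ->
  p i <= p j.
Proof.
move=> [_ pS] /andP[ij jN]; elim: j ij jN => [|j IH].
  by rewrite leqn0 => /eqP ->.
rewrite leq_eqVlt => /predU1P[->//|]; rewrite ltnS => ij jN.
by rewrite (le_trans (IH ij (ltnW jN)))// ltW// pS.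
Qed.

(* [I] behaves as an indefinite integral of [f] with respect to [dG]. *)
Definition rs_primitive a b f G I := forall u v c e,
  a <= u -> u <= v -> v <= b ->
  (forall x, u < x -> x <= v -> `|f x - c| <= e) ->
  `|I v - I u - c * (G v - G u)| <= e * (G v - G u).

(** Both the sum and [I T - I 0] split over the partition. On each cell [f] stays close to its value
    at the tag, and the resulting errors are proportional to increments of [G], which telescope. *)
Lemma rs_limit_primitive T f G I : 0 < T -> {within `[0, T], continuous f} ->
  rs_primitive 0 T f G I -> G 0 <= G T -> rs_limit T f G (I T - I 0).
Proof.
move=> T0 cf fGI G0T e e0.
(* The added 1 keeps the divisor positive when [G T = G 0] and makes the final inequality strict. *)
have L0 : 0 < G T - G 0 + 1 by rewrite ltr_wpDl// subr_ge0.
have [d d0 fd] := within_continuous_uniform cf (divr_gt0 e0 L0).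
exists d => // N p tau [sp p0 pN mesh tags].
have -> : I T - I 0 = \sum_(k < N) (I (p k.+1) - I (p k)).
  by rewrite -(big_mkord xpredT (fun k => I (p k.+1) - I (p k))) telescope_sumr// pN p0.
rewrite -sumrB (le_lt_trans (ler_norm_sum _ _ _))//.
apply: (@le_lt_trans _ _ (\sum_(k < N) e / (G T - G 0 + 1) * (G (p k.+1) - G (p k)))).
  apply: ler_sum => k _.
  have kN := ltn_ord k.
  have /andP[pk0 pkT] := subdivision_bounds sp (ltnW kN).
  have /andP[pS0 pST] := subdivision_bounds sp kN.
  have pkS : p k <= p k.+1 by rewrite (subdivision_le sp)// leqnSn.
  rewrite distrC; apply: fGI => // x xk xS.
  move: (tags k kN); rewrite in_itv/= => /andP[tk tS].
  apply: fd; rewrite ?in_itv/= ?(le_trans pk0) ?(le_trans _ pST)// ?(ltW xk)//.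
  by have := mesh k kN; rewrite ltr_norml; lra.
rewrite -mulr_sumr -(big_mkord xpredT (fun k => G (p k.+1) - G (p k))).
rewrite telescope_sumr// pN p0 mulrAC ltr_pdivrMr// ltr_pM2l//.
by rewrite ltrDl.
Qed.
End RiemannStieltjes.

(** * Right-continuous modifications *)

Section RightModification.
Context {R : realType}.
Implicit Types (a b t x y : R) (g p q : R -> R).

Lemma clamp_in a b t : a <= b -> clamp a b t \in `[a, b].
Proof. by move=> ab; rewrite in_itv/= /clamp le_max lexx/= ge_max ab ge_min lexx orbT. Qed.

Lemma clampE a b t : t \in `[a, b] -> clamp a b t = t.
Proof.
by rewrite in_itv/= => /andP[at_ tb]; rewrite /clamp (min_idPl tb) (max_idPr at_).
Qed.

Lemma clamp_le a b : {homo clamp a b : x y / x <= y}.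
Proof.
by move=> x y xy; rewrite /clamp ge_max !le_max lexx/= le_min !ge_min xy lexx !orbT.
Qed.

Lemma clamp_lt a b t x : clamp a b t < x -> x <= b -> t < x.
Proof.
rewrite /clamp gt_max gt_min => /andP[_ /orP[//|bx xb]].
by have := lt_le_trans bx xb; rewrite ltxx.
Qed.

Lemma continuous_clamp a b : continuous (clamp a b).
Proof.
move=> x; apply: (@continuous_max _ R^o (cst a) (fun t => Num.min t b)).
  exact: cst_continuous.
apply: (@continuous_min _ R^o id (cst b)); first exact: id.
exact: cst_continuous.
Qed.

Lemma nondecreasing_right_lim a b p x : {in `[a, b] &, nondecreasing_fun p} ->
  a <= x -> x < b -> exists l, [/\ p y @[y --> x^'+] --> l, p x <= l &
    forall y, x < y -> y <= b -> l <= p y].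
Proof.
move=> pnd ax xb.
have axb y : x <= y -> y <= b -> y \in `[a, b].
  by move=> xy yb; rewrite in_itv/= (le_trans ax xy).
have pcv : cvg (p y @[y --> x^'+]).
  apply: nondecreasing_at_right_is_cvgr; near=> z.
    move=> u v; rewrite !in_itv/= => /andP[xu uz] /andP[xv vz] uv.
    have zb : z <= b by near: z; exact: nbhs_right_le.
    by apply: pnd => //; apply: axb; rewrite ?(ltW xu) ?(ltW xv) ?(le_trans _ zb) ?ltW.
  exists (p x); move=> w [u /=]; rewrite in_itv/= => /andP[xu uz] <-.
  have zb : z <= b by near: z; exact: nbhs_right_le.
  by apply: pnd; rewrite ?axb ?lexx ?(ltW xu) ?(ltW xb)// (le_trans _ zb)// ltW.
exists (lim (p y @[y --> x^'+])); split => //.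
  apply: limr_ge => //; near=> z.
  have zb : z <= b by near: z; exact: nbhs_right_le.
  have xz : x <= z by near: z; exact: nbhs_right_ge.
  by apply: pnd; rewrite ?axb ?lexx ?(ltW xb).
move=> y xy yb; apply: limr_le => //; near=> z.
have zy : z <= y by near: z; exact: nbhs_right_le.
have xz : x <= z by near: z; exact: nbhs_right_ge.
by apply: pnd; rewrite ?axb ?(ltW xy) ?(le_trans zy).
Unshelve. all: by end_near. Qed.

Lemma rc_modification_b a b g : a < b -> rc_modification a b g b = g b.
Proof.
by move=> ab; rewrite /rc_modification clampE ?ltxx// in_itv/= lexx ltW.
Qed.

Lemma rc_modification_in a b g x : a <= x -> x < b ->
  rc_modification a b g x = lim (g y @[y --> x^'+]).
Proof.
by move=> ax xb; rewrite /rc_modification clampE ?in_itv/= ?ax ?ltW// xb.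
Qed.

Lemma rc_modification_clamp a b g x : a < b ->
  rc_modification a b g (clamp a b x) = rc_modification a b g x.
Proof.
by move=> ab; rewrite /rc_modification [clamp a b (clamp _ _ _)]clampE// clamp_in// ltW.
Qed.

Lemma rc_modification_nondecreasing a b p : a < b ->
  {in `[a, b] &, nondecreasing_fun p} ->
  {homo rc_modification a b p : x y / x <= y}.
Proof.
move=> ab pnd.
suff mono x y : x \in `[a, b] -> y \in `[a, b] -> x < y ->
    rc_modification a b p x <= rc_modification a b p y.
  move=> x y /(clamp_le a b); rewrite -(rc_modification_clamp _ x)//.
  rewrite -(rc_modification_clamp _ y)// le_eqVlt => /predU1P[->//|].
  by apply: mono; rewrite clamp_in// ltW.
rewrite !in_itv/= => /andP[ax xb] /andP[ay yb] xy.
have xltb := lt_le_trans xy yb.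
have [l [xl pxl ly]] := nondecreasing_right_lim pnd ax xltb.
rewrite rc_modification_in// (cvg_lim _ xl)//.
move: yb; rewrite le_eqVlt => /predU1P[yb|yb].
  by rewrite yb rc_modification_b// -yb ly// yb.
have [l' [yl' pyl' _]] := nondecreasing_right_lim pnd ay yb.
by rewrite rc_modification_in// (cvg_lim _ yl')// (le_trans _ pyl')// ly// ltW.
Qed.

(** A bound on the distance from [g z] to the right limit at [x], valid for all [z] in []x, x + d[],
    survives the passage to the right limit at any [y] of that interval. *)
Lemma rc_modification_right_continuous a b g x :
  (forall y, a <= y -> y < b -> cvg (g z @[z --> y^'+])) ->
  a <= x -> x < b ->
  rc_modification a b g y @[y --> x^'+] --> rc_modification a b g x.
Proof.
move=> gcv ax xb; rewrite rc_modification_in//.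
apply/cvgrPdist_le => e e0.
have /cvgrPdist_le /(_ _ e0) := gcv x ax xb.
move=> [d /= d0 dg].
near=> y.
have xy : x < y by near: y; exact: nbhs_right_gt.
have yb : y < b by near: y; exact: nbhs_right_lt.
have yd : y < x + d by near: y; apply: nbhs_right_lt; rewrite ltrDl.
rewrite rc_modification_in ?(le_trans ax (ltW xy))//.
have ay := le_trans ax (ltW xy).
have gy := gcv y ay yb.
have ge z : y < z -> z < x + d -> `|lim (g y @[y --> x^'+]) - g z| <= e.
  move=> yz zd; apply: dg => /=; last exact: lt_trans yz.
  rewrite -[x - z]opprB normrN gtr0_norm ?subr_gt0 ?(lt_trans xy)//.
  by rewrite ltrBlDl.
rewrite ler_distlC; apply/andP; split.
  apply: limr_ge => //; near=> z.
  have : y < z by near: z; exact: nbhs_right_gt.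
  have : z < x + d by near: z; exact: nbhs_right_lt.
  by move=> zd yz; have := ge z yz zd; rewrite ler_distlC => /andP[].
apply: limr_le => //; near=> z.
have : y < z by near: z; exact: nbhs_right_gt.
have : z < x + d by near: z; exact: nbhs_right_lt.
by move=> zd yz; have := ge z yz zd; rewrite ler_distlC => /andP[].
Unshelve. all: by end_near. Qed.

Lemma bounded_variation_jordan a b g : bounded_variation a b g -> exists p q,
  [/\ {in `[a, b] &, nondecreasing_fun p}, {in `[a, b] &, nondecreasing_fun q} &
      {in `[a, b], g =1 p \- q}].
Proof.
move=> bg; exists (fine \o pos_tv a g), (fine \o neg_tv a g); split.
- by apply: fine_neg_tv_nondecreasing; exact: bounded_variationN.
- exact: fine_neg_tv_nondecreasing.
- exact: bounded_variation_pos_neg_tvE.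
Qed.

Lemma bounded_variation_right_cvg a b g x : bounded_variation a b g ->
  a <= x -> x < b -> cvg (g y @[y --> x^'+]).
Proof.
move=> /bounded_variation_jordan[p [q [pnd qnd gpq]]] ax xb.
have [l [pl _ _]] := nondecreasing_right_lim pnd ax xb.
have [m [qm _ _]] := nondecreasing_right_lim qnd ax xb.
apply/cvg_ex; exists (l - m); apply: cvg_trans (cvgB pl qm).
apply: near_eq_cvg; near=> z; rewrite gpq// in_itv/=.
have -> : z <= b by near: z; exact: nbhs_right_le.
by rewrite andbT (le_trans ax)//; near: z; exact: nbhs_right_ge.
Unshelve. all: by end_near. Qed.

(** The modification commutes with the difference in a Jordan decomposition and preserves
    monotonicity of both terms. *)
Lemma rc_modification_bounded_variation a b g : a < b ->
  bounded_variation a b g -> bounded_variation a b (rc_modification a b g).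
Proof.
move=> ab /bounded_variation_jordan[p [q [pnd qnd gpq]]].
have -> : rc_modification a b g =
    rc_modification a b p \+ (\- rc_modification a b q).
  apply/funext => t; rewrite /= -(rc_modification_clamp g)//.
  rewrite -(rc_modification_clamp p)// -(rc_modification_clamp q)//.
  have := clamp_in t (ltW ab); move: (clamp a b t) => {}t tab.
  move: (tab); rewrite in_itv/= => /andP[at_]; rewrite le_eqVlt => /predU1P[->|tb].
    by rewrite !rc_modification_b// gpq// in_itv/= lexx ltW.
  have [l [pl _ _]] := nondecreasing_right_lim pnd at_ tb.
  have [m [qm _ _]] := nondecreasing_right_lim qnd at_ tb.
  rewrite !rc_modification_in// (cvg_lim _ pl)// (cvg_lim _ qm)//.
  apply: cvg_lim => //; apply: cvg_trans (cvgB pl qm).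
  apply: near_eq_cvg; near=> z; rewrite gpq// in_itv/=.
  have -> : z <= b by near: z; exact: nbhs_right_le.
  by rewrite andbT (le_trans at_)//; near: z; exact: nbhs_right_ge.
apply: bounded_variationD; first exact: ab.
  apply: nondecreasing_bounded_variation => x y _ _.
  exact: rc_modification_nondecreasing.
apply: bounded_variationN.
apply: nondecreasing_bounded_variation => x y _ _.
exact: rc_modification_nondecreasing.
Unshelve. all: by end_near. Qed.

(** One statement serves both variations, since the positive variation of a function is the negative
    variation of its opposite. Outside [[a, b]] clamping makes the function constant. *)
Lemma neg_tv_clamp_cumulative a b g : a < b -> bounded_variation a b g ->
  (forall x, a <= x -> x < b -> g y @[y --> x^'+] --> g x) ->
  is_cumulative (fun t => fine (neg_tv a g (clamp a b t))).
Proof.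
move=> ab bg grc; split=> [x y xy|x].
  apply: (fine_neg_tv_nondecreasing bg).
  - exact: clamp_in (ltW ab).
  - exact: clamp_in (ltW ab).
  - exact: clamp_le.
have [ax|xa] := leP a x; last first.
  rewrite [X in _ --> X](_ : _ = fine (neg_tv a g a)); last first.
    by rewrite /clamp (min_idPl (ltW (lt_trans xa ab))) (max_idPl (ltW xa)).
  have cc : (fun=> fine (neg_tv a g a)) z @[z --> x^'+] --> fine (neg_tv a g a).
    exact: cvg_cst.
  apply: cvg_trans cc.
  apply: near_eq_cvg; near=> z.
  have za : z <= a by near: z; exact: nbhs_right_le.
  by rewrite /clamp (min_idPl (le_trans za (ltW ab))) (max_idPl za).
have [xb|bx] := ltP x b; last first.
  rewrite [X in _ --> X](_ : _ = fine (neg_tv a g b)); last first.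
    by rewrite /clamp (min_idPr bx) (max_idPr (ltW ab)).
  have cc : (fun=> fine (neg_tv a g b)) z @[z --> x^'+] --> fine (neg_tv a g b).
    exact: cvg_cst.
  apply: cvg_trans cc.
  apply: near_eq_cvg; near=> z.
  have bz : b <= z by rewrite (le_trans bx)//; near: z; exact: nbhs_right_ge.
  by rewrite /clamp (min_idPr bz) (max_idPr (ltW ab)).
rewrite clampE ?in_itv/= ?ax ?ltW//.
apply: cvg_trans (neg_tv_right_continuous ax xb bg (grc x ax xb)).
apply: near_eq_cvg; near=> z.
rewrite clampE ?in_itv//= (le_trans ax) /=; last by near: z; exact: nbhs_right_ge.
by near: z; exact: nbhs_right_le.
Unshelve. all: by end_near. Qed.

Lemma pos_part_bv_cumulative a b g : a < b -> bounded_variation a b g ->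
  is_cumulative (pos_part_bv a b g).
Proof.
move=> ab bg; apply: neg_tv_clamp_cumulative => //.
  by apply: bounded_variationN; exact: rc_modification_bounded_variation.
move=> x ax xb; apply: cvgN; apply: rc_modification_right_continuous => //.
by move=> y ay yb; exact: bounded_variation_right_cvg bg ay yb.
Qed.

Lemma neg_part_bv_cumulative a b g : a < b -> bounded_variation a b g ->
  is_cumulative (neg_part_bv a b g).
Proof.
move=> ab bg; apply: neg_tv_clamp_cumulative => //.
  exact: rc_modification_bounded_variation.
move=> x ax xb; apply: rc_modification_right_continuous => //.
by move=> y ay yb; exact: bounded_variation_right_cvg bg ay yb.
Qed.

Lemma pos_part_bvB a b g t : a < b -> bounded_variation a b g ->
  pos_part_bv a b g t - neg_part_bv a b g t = rc_modification a b g t.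
Proof.
move=> ab bg; rewrite -(rc_modification_clamp g t ab).
have := bounded_variation_pos_neg_tvE (rc_modification_bounded_variation ab bg).
by move=> ->; last exact: clamp_in (ltW ab).
Qed.

Lemma to_cumulativeE (h : R -> R) : is_cumulative h -> to_cumulative h = h :> (R -> R).
Proof. by rewrite /to_cumulative; case: pselect. Qed.

End RightModification.

(** * Integrals as primitives, and summation by parts *)

Lemma integrable_mull d (X : measurableType d) (R : realType)
    (mu : {measure set X -> \bar R}) (D : set X) (k : R) (h : X -> R) :
  measurable D -> mu.-integrable D (EFin \o h) ->
  mu.-integrable D (EFin \o (fun x => k * h x)).
Proof. by move=> mD ih; exact: (integrableZl mD k ih). Qed.

Lemma integrable_sub d (X : measurableType d) (R : realType)
    (mu : {measure set X -> \bar R}) (D : set X) (g h : X -> R) :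
  measurable D -> mu.-integrable D (EFin \o g) -> mu.-integrable D (EFin \o h) ->
  mu.-integrable D (EFin \o (fun x => g x - h x)).
Proof. by move=> mD ig ih; exact: (integrableB mD ig ih). Qed.

Section StieltjesPrimitive.
Context {R : realType}.
Implicit Types (a b s T c e : R) (f g w G I : R -> R).

(** The inequality to prove is that the integral of [(f - c) * w] is at most [e] times that of [w].
    Two instances are needed: [w = 1] with a Stieltjes measure, and the derivative of the kernel
    with Lebesgue measure. *)
Lemma rs_primitive_integral (mu : {measure set (measurableTypeR R) -> \bar R})
    a b f w G :
  measurable_fun `]a, b] f -> (exists M : R, forall x, x \in `]a, b] -> `|f x| <= M) ->
  mu.-integrable `]a, b] (EFin \o w) -> (forall x, x \in `]a, b] -> 0 <= w x) ->
  (forall u v, a <= u -> u <= v -> v <= b ->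
    G v - G u = \int[mu]_(x in `]u, v]) w x) ->
  rs_primitive a b f G (fun v => \int[mu]_(x in `]a, v]) (f x * w x)).
Proof.
move=> mf [M fM] iw w0 GE u v c e au uv vb fce.
have sub_ab : `]u, v] `<=` `]a, b].
  move=> x /=; rewrite !in_itv/= => /andP[ux xv].
  by rewrite (le_lt_trans au ux) (le_trans xv vb).
have mw : measurable_fun `]a, b] w.
  by apply/measurable_EFinP; case/integrableP: iw.
have iZ k (D : set R) (h : R -> R) : measurable D -> mu.-integrable D (EFin \o h) ->
    mu.-integrable D (EFin \o (fun x => k * h x)).
  by move=> mD ih; exact: integrable_mull.
have ifw : mu.-integrable `]a, b] (EFin \o (fun x => f x * w x)).
  apply: (@le_integrable _ _ _ mu _ _ _ (fun x => (M * w x)%:E)) => //.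
  - by apply/measurable_EFinP; exact: measurable_funM.
  - move=> x xab /=; rewrite lee_fin !normrM ler_wpM2r//.
    by rewrite (le_trans (fM x xab))// ler_norm.
  - exact: (iZ M).
have iS (h : R -> R) : mu.-integrable `]a, b] (EFin \o h) ->
    mu.-integrable `]u, v] (EFin \o h).
  by apply: integrableS.
have -> : \int[mu]_(x in `]a, v]) (f x * w x) - \int[mu]_(x in `]a, u]) (f x * w x) =
    \int[mu]_(x in `]u, v]) (f x * w x).
  have avE : `]a, v]%classic = `]a, u] `|` `]u, v] :> set R.
    by rewrite -itv_bndbnd_setU// bnd_simp.
  have iav : mu.-integrable (`]a, u] `|` `]u, v]) (EFin \o (fun x => f x * w x)).
    rewrite -avE; apply: integrableS ifw => // x /=.
    by rewrite !in_itv/= => /andP[-> /le_trans ->].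
  have dav : [disjoint `]a, u]%classic & `]u, v]%classic]%classic.
    apply/disj_setPS => x [] /=; rewrite !in_itv/= => /andP[_ xu] /andP[+ _].
    by rewrite ltNge xu.
  by rewrite avE (Rintegral_setU _ _ iav dav)// addrAC subrr add0r.
rewrite GE// -RintegralZl//; last exact: iS.
rewrite -RintegralZl//; last exact: iS.
rewrite -RintegralB//; [|exact: iS|by apply: iZ => //; exact: iS].
have iB : mu.-integrable `]u, v] (EFin \o (fun x => f x * w x - c * w x)).
  apply: integrable_sub => //; first exact: iS.
  by apply: iZ => //; exact: iS.
apply: (le_trans (le_normr_Rintegral _ iB)) => //.
apply: le_Rintegral => //.
- exact: (integrable_norm iB).
- by apply: iZ => //; exact: iS.
- move=> x xuv; rewrite -mulrBl normrM (ger0_norm (w0 x (sub_ab x xuv))).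
  rewrite ler_wpM2r ?w0//; first exact: sub_ab.
  by move: xuv => /=; rewrite in_itv/= => /andP[]; exact: fce.
Qed.

(** Carries a primitive from [[s, T]] to [[0, T]], where the partitions live: the clamped functions
    have no increments outside [[a, b]]. *)
Lemma rs_primitive_clamp a b a' b' f G I : a <= b -> rs_primitive a b f G I ->
  rs_primitive a' b' f (G \o clamp a b) (I \o clamp a b).
Proof.
move=> ab fGI u v c e _ uv _ fce /=.
have := clamp_in u ab; have := clamp_in v ab; rewrite !in_itv/=.
move=> /andP[_ vb] /andP[ua _]; apply: fGI => //; first exact: clamp_le.
move=> x xu xv; apply: fce.
  exact: clamp_lt xu (le_trans xv vb).
move: xv; rewrite /clamp le_max leNgt (le_lt_trans ua xu)/= le_min.
by move=> /andP[].
Qed.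

Lemma continuous_bounded_itv a b f : {within `[a, b], continuous f} ->
  exists M : R, forall x, x \in `[a, b] -> `|f x| <= M.
Proof.
move=> cf; have := compact_bounded (continuous_compact cf (segment_compact (a:=a) (b:=b))).
move=> [M [_ /(_ (M + 1))]]; rewrite ltrDl ltr01 => /(_ isT) fM.
by exists (M + 1) => x xab; apply: fM => /=; exists x.
Qed.

Lemma continuous_measurable_itv a b f : {within `[a, b], continuous f} ->
  measurable_fun `[a, b] f.
Proof. by move=> cf; exact: subspace_continuous_measurable_fun. Qed.

Lemma rs_primitive_stieltjes (F : cumulative R R) a b f :
  {within `[a, b], continuous f} ->
  rs_primitive a b f F
    (fun v => \int[lebesgue_stieltjes_measure F]_(x in `]a, v]) f x).
Proof.
move=> cf; pose mu : {measure set (measurableTypeR R) -> \bar R} :=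
  lebesgue_stieltjes_measure F.
change (rs_primitive a b f F (fun v => \int[mu]_(x in `]a, v]) f x)).
have [M fM] := continuous_bounded_itv cf.
have sub_cc : `]a, b] `<=` `[a, b].
  by move=> x /=; rewrite !in_itv/= => /andP[/ltW -> ->].
have -> : (fun v => \int[mu]_(x in `]a, v]) f x) =
    (fun v => \int[mu]_(x in `]a, v]) (f x * cst 1 x)).
  by apply/funext => v; apply: eq_Rintegral => x _; rewrite mulr1.
have Rcst u v : \int[mu]_(x in `]u, v]) (cst 1 x) = fine (mu `]u, v]%classic).
  by rewrite Rintegral_cst// mul1r.
have muE u v : u <= v -> mu `]u, v]%classic = (F v - F u)%:E.
  exact: stieltjes_itv_oc.
apply: rs_primitive_integral => //.
- by apply: measurable_funS (continuous_measurable_itv cf).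
- by exists M => x /sub_cc; exact: fM.
- have [ba|ab] := leP b a.
    by rewrite set_itv_ge ?bnd_simp -?leNgt//; exact: integrable_set0.
  apply: measurable_bounded_integrable => //.
    by rewrite muE ?ltry// ltW.
  exists 1; split => // y y1 x _ /=; rewrite normr1; exact: ltW.
- by move=> u v au uv vb; rewrite Rcst muE.
Qed.

Lemma rs_limit_ext T f g g' l : {in `[0, T], g =1 g'} -> rs_limit T f g' l ->
  rs_limit T f g l.
Proof.
move=> gg' gl e e0; have [d d0 dP] := gl e e0; exists d => // N p tau pN.
have -> : rs_sum f g N p tau = rs_sum f g' N p tau; last exact: dP.
have [[pT _] _ _ _ _] := pN.
by apply: eq_bigr => k _; rewrite (gg' (p k)) ?(gg' (p k.+1))//; apply: pT => //; exact: ltnW.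
Qed.

Lemma rs_limitZ T f g l c : rs_limit T f g l -> rs_limit T f (c \*: g) (c * l).
Proof.
move=> gl e e0; have c0 : 0 < `|c| + 1 by rewrite ltr_wpDl.
have [d d0 dP] := gl _ (divr_gt0 e0 c0).
exists d => // N p tau pN.
have -> : rs_sum f (c \*: g) N p tau = c * rs_sum f g N p tau.
  by rewrite mulr_sumr; apply: eq_bigr => k _; rewrite /= -[_ *: g _]/(_ * _) -[_ *: g (p k)]/(_ * _); ring.
rewrite -mulrBr normrM.
have := dP _ _ _ pN; rewrite ltr_pdivlMr//; apply: le_lt_trans.
by rewrite mulrC ler_wpM2l// lerDl.
Qed.

Lemma sum_by_parts (f g : nat -> R) n :
  \sum_(k < n.+1) f k * (g k.+1 - g k) =
  f n * g n.+1 - f 0%N * g 0%N - \sum_(k < n) (f k.+1 - f k) * g k.+1.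
Proof.
elim: n => [|n IH]; first by rewrite big_ord_recl !big_ord0/=; ring.
by rewrite big_ord_recr/= IH [in RHS]big_ord_recr/=; ring.
Qed.

(* Summation by parts moves the differences onto [f], whose oscillation on a
   fine partition is small. *)
Lemma rs_limit_summable T f g M : 0 < T -> {within `[0, T], continuous f} ->
  g 0 = 0 -> g T = 0 ->
  (forall N p, subdivision T N p -> \sum_(k < N) `|g (p k)| <= M) ->
  rs_limit T f g 0.
Proof.
move=> T0 cf g0 gT gM e e0.
have M0 : 0 <= M.
  have sub0 : subdivision T 0 (fun=> 0 : R).
    by split=> // k _; rewrite in_itv/= lexx ltW.
  by apply: le_trans (gM _ _ sub0); rewrite big_ord0.
have M10 : 0 < M + 1 by rewrite ltr_wpDl.
have [d d0 fd] := within_continuous_uniform cf (divr_gt0 e0 M10).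
(* Consecutive tags lie in adjacent cells, hence less than two meshes apart. *)
have d20 : 0 < d / 2 by rewrite divr_gt0.
exists (d / 2) => // N p tau [sp p0 pN mesh tags]; rewrite subr0.
have [n NE] : exists n, N = n.+1.
  case: N pN {sp mesh tags} => [|n _]; last by exists n.
  by rewrite p0 => T0'; move: T0; rewrite -T0' ltxx.
rewrite /rs_sum NE (sum_by_parts (f \o tau) (g \o p))/= -NE pN p0 gT g0.
rewrite !mulr0 subrr sub0r normrN (le_lt_trans (ler_norm_sum _ _ _))//.
apply: (@le_lt_trans _ _ (\sum_(k < n) e / (M + 1) * `|g (p k.+1)|)).
  apply: ler_sum => k _; rewrite normrM ler_wpM2r//.
  have kN : (k.+1 < N)%N by rewrite NE ltnS.
  have kN' := ltnW kN.
  have := tags _ kN; have := tags _ kN'; rewrite !in_itv/=.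
  move=> /andP[t1 t2] /andP[t3 t4].
  have /andP[pk0 _] := subdivision_bounds sp (ltnW kN').
  have /andP[_ pST] := subdivision_bounds sp kN.
  have := mesh _ kN; have := mesh _ kN'.
  move=> m1 m2; apply: fd; rewrite ?in_itv/=.
  - by apply/andP; split; lra.
  - by apply/andP; split; lra.
  - by rewrite ltr_norml; apply/andP; split; lra.
rewrite -mulr_sumr.
have gM' : \sum_(k < n) `|g (p k.+1)| <= M.
  by apply: le_trans (gM _ _ sp); rewrite NE big_ord_recl/= lerDr.
rewrite mulrAC ltr_pdivrMr// ltr_pM2l// (le_lt_trans gM')//.
by rewrite ltrDl.
Qed.

End StieltjesPrimitive.

(** * Stieltjes sums of a function of bounded variation *)

Section StieltjesLimit.
Context {R : realType}.
Implicit Types (s T : R) (f g p q : R -> R).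

(* The jump of a nondecreasing function at a point of a subdivision is at most
   its increment over the next interval. *)
Lemma sum_jumps_le T s g p q N (t : nat -> R) : 0 <= s ->
  {in `[0, T] &, nondecreasing_fun p} -> {in `[0, T] &, nondecreasing_fun q} ->
  {in `[0, T], g =1 p \- q} -> 0 <= T -> subdivision T N t ->
  \sum_(k < N) `|if t k < s then 0 else g (t k) - rc_modification s T g (t k)|
    <= (p T - p 0) + (q T - q 0).
Proof.
move=> s0 pnd qnd gpq T0 st.
have in0 : 0 \in `[0, T] by rewrite in_itv/= lexx.
have inT : T \in `[0, T] by rewrite in_itv/= lexx andbT.
have tin k : (k <= N)%N -> t k \in `[0, T] by case: st => + _; exact.
have tele (r : R -> R) : {in `[0, T] &, nondecreasing_fun r} ->
    \sum_(k < N) (r (t k.+1) - r (t k)) <= r T - r 0.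
  move=> rnd; rewrite -(big_mkord xpredT (fun k => r (t k.+1) - r (t k))).
  rewrite telescope_sumr//.
  have := tin _ (leqnn N); have := tin _ (leq0n N); rewrite !in_itv/=.
  by move=> /andP[t0 _] /andP[_ tT]; apply: lerB; apply: rnd => //; exact: tin.
apply: le_trans (lerD (tele _ pnd) (tele _ qnd)); rewrite -big_split/=.
apply: ler_sum => k _.
have kN := ltn_ord k; have tk := tin k (ltnW kN); have tk1 := tin k.+1 kN.
have tkS : t k < t k.+1 by case: st => _; exact.
have p1 : p (t k) <= p (t k.+1) by rewrite pnd// ltW.
have q1 : q (t k) <= q (t k.+1) by rewrite qnd// ltW.
case: ltP => [_|stk]; first by rewrite normr0 addr_ge0// subr_ge0.
move: (tk) (tk1); rewrite !in_itv/= => /andP[tk0 tkT] /andP[_ tk1T].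
have tkT' := lt_le_trans tkS tk1T.
have [l [pl pl1 /(_ _ tkS tk1T) lp]] := nondecreasing_right_lim pnd tk0 tkT'.
have [m [qm qm1 /(_ _ tkS tk1T) mq]] := nondecreasing_right_lim qnd tk0 tkT'.
have -> : rc_modification s T g (t k) = l - m.
  rewrite rc_modification_in//; apply: cvg_lim => //.
  apply: cvg_trans (cvgB pl qm); apply: near_eq_cvg; near=> z.
  have zT : z <= T by near: z; exact: nbhs_right_le.
  have tz : t k <= z by near: z; exact: nbhs_right_ge.
  by rewrite gpq// in_itv/= (le_trans tk0 tz).
by rewrite gpq//= ler_norml; apply/andP; split; lra.
Unshelve. all: by end_near. Qed.

(** Subtracting 1 changes no increment; it makes the step vanish on [[s, T]] and equal -1 before
    [s], the normalisation needed when it is added to a function frozen to the left of [s]. *)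
Lemma rs_limit_jump T s f : 0 < s -> s < T -> {within `[0, T], continuous f} ->
  rs_limit T f (fun t => (s <= t)%R%:R - 1) (f s).
Proof.
move=> s0 sT cf.
pose I (t : R) := f s * (s <= t)%R%:R.
have -> : f s = I T - I 0.
  by rewrite /I (ltW sT) leNgt s0 mulr1 mulr0 subr0.
apply: rs_limit_primitive => //; first exact: lt_trans sT.
  move=> u v c e _ uv _ fce; rewrite /I.
  have [su|us] := leP s u.
    by rewrite (le_trans su uv)/= !subrr !mulr0 subrr normr0.
  have [sv|vs] := leP s v; last by rewrite !subrr !mulr0 subrr normr0.
  rewrite (_ : true%:R - 1 - (false%:R - 1) = 1 :> R); last by rewrite /=; ring.
  by rewrite /= mulr1 mulr0 subr0 !mulr1 fce.
by rewrite lerD2r ler_nat (leNgt s 0) s0.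
Qed.

Lemma rs_limit_stieltjes (F : cumulative R R) s T f : 0 < s -> s < T ->
  {within `[0, T], continuous f} ->
  rs_limit T f (F \o clamp s T)
    (\int[lebesgue_stieltjes_measure F]_(x in `]s, T]) f x).
Proof.
move=> s0 sT cf; have T0 := lt_trans s0 sT.
have cfs : {within `[s, T], continuous f}.
  apply: continuous_subspaceW cf => x /=; rewrite !in_itv/= => /andP[+ ->].
  by move/(le_trans (ltW s0)) ->.
have := rs_primitive_clamp (a' := 0) (b' := T) (ltW sT) (rs_primitive_stieltjes F cfs).
have F0T : (F \o clamp s T) 0 <= (F \o clamp s T) T.
  by apply: cumulative_is_nondecreasing; apply: clamp_le; exact: ltW.
move=> /(rs_limit_primitive T0 cf)/(_ F0T).
rewrite /= [clamp s T T]clampE ?in_itv/= ?lexx ?ltW//.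
have -> : clamp s T 0 = s by rewrite /clamp (min_idPl (ltW T0)) (max_idPl (ltW s0)).
by rewrite set_itvoc0 Rintegral_set0 subr0.
Qed.

(** With [h] the modification extended to the left by its value [h s = g(s+)], on [[0, T]] the
    function [g] is the sum of [phi], of [g(s+)] times the step that is -1 before [s] and 0 after,
    and of [h]. Before [s] the last two cancel, in accordance with [g t = 0]. *)
Lemma rs_limit_bounded_variation T s f g : 0 < s -> s < T ->
  {within `[0, T], continuous f} -> bounded_variation 0 T g ->
  (forall t, 0 <= t -> t < s -> g t = 0) ->
  rs_limit T f g (lim (g t @[t --> s^'+]) * f s + stieltjes_integral s T g f).
Proof.
move=> s0 sT cf bg g0; have T0 := lt_trans s0 sT.
have bgs : bounded_variation s T g := bounded_variationr (ltW s0) (ltW sT) bg.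
pose phi t := if t < s then 0 else g t - rc_modification s T g t.
have phi0 : rs_limit T f phi 0.
  have [p [q [pnd qnd gpq]]] := bounded_variation_jordan bg.
  apply: (@rs_limit_summable _ _ _ _ (p T - p 0 + (q T - q 0))) => //.
  - by rewrite /phi s0.
  - by rewrite /phi ltNge (ltW sT)/= rc_modification_b// subrr.
  - by move=> N t st; apply: sum_jumps_le => //; exact: ltW.
have clampK t : clamp s T (clamp s T t) = clamp s T t.
  by rewrite clampE// clamp_in// ltW.
have pos := rs_limit_stieltjes (to_cumulative (pos_part_bv s T g)) s0 sT cf.
have neg := rs_limit_stieltjes (to_cumulative (neg_part_bv s T g)) s0 sT cf.
rewrite (to_cumulativeE (pos_part_bv_cumulative sT bgs)) in pos.
rewrite (to_cumulativeE (neg_part_bv_cumulative sT bgs)) in neg.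
have jump := rs_limitZ (lim (g t @[t --> s^'+])) (rs_limit_jump s0 sT cf).
have := rs_limitD phi0 (rs_limitD jump (rs_limitD pos (rs_limitN neg))).
rewrite add0r -/(stieltjes_integral s T g f); apply: rs_limit_ext => t.
rewrite in_itv/= => /andP[t0 tT] /=; rewrite -[_ *: _]/(_ * _).
rewrite /pos_part_bv /neg_part_bv !clampK -/(pos_part_bv s T g t).
rewrite -/(neg_part_bv s T g t) pos_part_bvB// /phi.
have [ts|st] := ltP t s; last by rewrite subrr mulr0; ring.
rewrite g0// -[rc_modification _ _ _ t]rc_modification_clamp//.
have -> : clamp s T t = s by rewrite /clamp (min_idPl tT) (max_idPl (ltW ts)).
by rewrite rc_modification_in//=; ring.
Qed.
End StieltjesLimit.

(** * The kernel operator on step functions *)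

Section KernelOperatorStep.
Context {R : realType} (T : R) (K : R -> R -> R) (Op : (R -> R) -> R -> R).
Hypothesis opK : kernel_operator T K Op.

Lemma chi_span_cons (c t : R) (f : R -> R) : t \in `[0, T] -> chi_span T f ->
  chi_span T (fun x => c * chi t x + f x).
Proof.
move=> tT [n [c' [t' [t'T ->]]]].
exists n.+1, (fun i => if i == n then c else c' i), (fun i => if i == n then t else t' i).
split=> [i|].
  by rewrite ltnS leq_eqVlt; case: eqVneq => //= _; exact: t'T.
apply/funext => x; rewrite big_ord_recr/= !eqxx addrC; congr (_ + _).
by apply: eq_bigr => i _; rewrite !ltn_eqF.
Qed.

Lemma chi_span0 : chi_span T (fun=> 0).
Proof.
exists 0%N, (fun=> 0), (fun=> 0); split => //.
by apply/funext => x; rewrite big_ord0.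
Qed.

Lemma chi_span_chi t : t \in `[0, T] -> chi_span T (chi t).
Proof.
move=> tT; have := chi_span_cons 1 tT chi_span0.
by congr chi_span; apply/funext => x; rewrite mul1r addr0.
Qed.

Lemma kernel_operator_cons (c t : R) (f : R -> R) s : t \in `[0, T] ->
  s \in `[0, T] -> chi_span T f ->
  Op (fun x => c * chi t x + f x) s = c * K t s + Op f s.
Proof.
move=> tT sT fspan.
rewrite (kernel_operator_linear opK)//; last exact: chi_span_chi.
by rewrite (kernel_operator_chi opK).
Qed.

Lemma kernel_operator0 s : s \in `[0, T] -> Op (fun=> 0) s = 0.
Proof.
move=> sT; have := kernel_operator_linear opK 1 chi_span0 chi_span0 sT.
by rewrite (_ : (fun=> _) = (fun=> 0 : R)); [lra|apply/funext => x; rewrite mul1r addr0].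
Qed.

Lemma kernel_operator_step N p a s : subdivision T N p -> s \in `[0, T] ->
  Op (step_fun N p a) s = \sum_(k < N) a k * (K (p k.+1) s - K (p k) s).
Proof.
move=> [pT _] sT.
(* Linearity is available only on [chi_span], so the induction also carries membership in it. *)
suff [] : Op (step_fun N p a) s = \sum_(k < N) a k * (K (p k.+1) s - K (p k) s) /\
  chi_span T (step_fun N p a) by [].
elim: N pT => [|N IH] pT.
  rewrite big_ord0 (_ : step_fun 0 p a = fun=> 0); last first.
    by apply/funext => x; rewrite /step_fun big_ord0.
  by split; [exact: kernel_operator0|exact: chi_span0].
have [|opN spanN] := IH; first by move=> k kN; apply: pT; exact: leqW.
rewrite (_ : step_fun N.+1 p a = fun x => a N * chi (p N.+1) x +
    (- a N * chi (p N) x + step_fun N p a x)); last first.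
  by apply/funext => x; rewrite /step_fun big_ord_recr/=; ring.
have pN : p N \in `[0, T] by apply: pT.
have pN1 : p N.+1 \in `[0, T] by apply: pT.
have spanN' := chi_span_cons (- a N) pN spanN.
split; last exact: chi_span_cons.
by rewrite !kernel_operator_cons// opN big_ord_recr/=; ring.
Qed.

Hypothesis K0 : forall t s, t \in `[0, T] -> s \in `[0, T] -> t < s -> K t s = 0.

Lemma chi_difference u v s : 0 < s -> u <= v ->
  chi v s - chi u s = ((u < s) && (s <= v))%:R :> R.
Proof.
move=> s0 uv; rewrite /chi !indicE !mem_setE !in_itv/= (ltW s0)/=.
have [su|us] := leP s u; first by rewrite (le_trans su uv) subrr.
by rewrite subr0.
Qed.

(** If [s] is in []p j, p j.+1]], the factor with [chi] selects [i = j] on the right. On the left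
    the terms before [j] vanish, and term [j] loses [K (p j) s]. If [s] is beyond [p N], both sides
    are zero. *)
Lemma kernel_operator_step_above N p a s : subdivision T N p ->
  s \in `]p 0%N, T] ->
  Op (step_fun N p a) s =
  \sum_(i < N) (chi (p i.+1) s - chi (p i) s) *
    (a i * K (p i.+1) s +
     \sum_(i.+1 <= k < N) a k * (K (p k.+1) s - K (p k) s)).
Proof.
move=> sp; rewrite in_itv/= => /andP[p0s sT].
have pN k : (k <= N)%N -> p k \in `[0, T] by case: sp => + _; exact.
have p00 : 0 <= p 0%N by have := pN 0%N isT; rewrite in_itv/= => /andP[].
have s0 : 0 < s by exact: le_lt_trans p0s.
have sT' : s \in `[0, T] by rewrite in_itv/= ltW.
rewrite kernel_operator_step//.
have zero k : (k <= N)%N -> p k < s -> K (p k) s = 0 by move=> kN; apply: K0; rewrite ?pN.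
pose D k := a k * (K (p k.+1) s - K (p k) s).
have D0 k : (k < N)%N -> p k.+1 < s -> D k = 0.
  move=> kN pS; have pk : p k < s.
    by rewrite (le_lt_trans _ pS)// (subdivision_le sp)// leqnSn.
  by rewrite /D (zero k.+1)// (zero k) 1?ltnW// subrr mulr0.
have chiE (i : 'I_N) : chi (p i.+1) s - chi (p i) s = ((p i < s) && (s <= p i.+1))%R%:R.
  by rewrite chi_difference// (subdivision_le sp)// leqnSn/=.
have [sN|Ns] := leP s (p N); last first.
  have pS (i : 'I_N) : p i.+1 < s.
    by rewrite (le_lt_trans _ Ns)// (subdivision_le sp)// (ltn_ord i) leqnn.
  rewrite !big1// => i _; last exact: D0 (pS i).
  by rewrite chiE [s <= _]leNgt pS andbF mul0r.
have [j] : exists j : 'I_N, (p j < s) && (s <= p j.+1).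
  have [n sn nmin] := @ex_minnP (fun n => s <= p n) (ex_intro _ N sN).
  have nN : (n <= N)%N by exact: nmin.
  case: n sn nmin nN => [|n] sn nmin nN.
    by move: sn; rewrite leNgt p0s.
  exists (Ordinal nN); rewrite sn andbT ltNge; apply/negP => /nmin.
  by rewrite ltnn.
move=> /andP[pjs spj]; have jN := ltn_ord j.
rewrite [RHS](bigD1 j)//= [X in _ = _ + X]big1 ?addr0; last first.
  move=> i ij; have iN := ltn_ord i; rewrite chiE; case: (ltngtP i j) => [lij|lji|eij].
  - have pS : p i.+1 <= p j by rewrite (subdivision_le sp)// lij ltnW.
    by rewrite [s <= _]leNgt (le_lt_trans pS pjs) andbF mul0r.
  - have pS : p j.+1 <= p i by rewrite (subdivision_le sp)// lji ltnW.
    by rewrite [_ < s]ltNge (le_trans spj pS) mul0r.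
  - by move: ij; rewrite -val_eqE/= eij eqxx.
rewrite chiE pjs spj/= mul1r -(big_mkord xpredT D)/=.
rewrite (big_cat_nat (n := j))//=; last exact: ltnW.
rewrite big_nat_cond big1 ?add0r; last first.
  move=> i /andP[/andP[_ ij] _]; apply: D0; first exact: ltn_trans jN.
  by rewrite (le_lt_trans _ pjs)// (subdivision_le sp)// ij ltnW.
by rewrite big_ltn// {1}/D (zero j) ?subr0// ltnW.
Qed.

End KernelOperatorStep.

(** * The bound on square-integrable functions *)

Lemma Lnorm2_sqr d (X : measurableType d) (R : realType)
    (mu : {measure set X -> \bar R}) (f : X -> R) :
  ('N[mu]_2%:E[EFin \o f] ^+ 2 = \int[mu]_x (f x ^+ 2)%:E)%E.
Proof.
have -> : (\int[mu]_x (f x ^+ 2)%:E = \int[mu]_x `|(EFin \o f) x| `^ 2)%E.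
  apply: eq_integral => x _ /=.
  by rewrite powR_mulrn// -normrX ger0_norm// sqr_ge0.
rewrite -powR_Lnorm//.
have := Lnorm_ge0 mu 2%:E (EFin \o f).
case: ('N[mu]_2%:E[EFin \o f])%E => [r||]//.
  by rewrite lee_fin => r0; rewrite -EFin_expe /= powR_mulrn.
by move=> _; rewrite /= pnatr_eq0.
Qed.

Lemma cauchy_schwarz_sqr d (X : measurableType d) (R : realType)
    (mu : {measure set X -> \bar R}) (f g : X -> R) :
  measurable_fun setT f -> measurable_fun setT g ->
  ((\int[mu]_x `|f x * g x|%:E) ^+ 2 <=
   (\int[mu]_x (f x ^+ 2)%:E) * (\int[mu]_x (g x ^+ 2)%:E))%E.
Proof.
move=> mf mg; rewrite -!Lnorm2_sqr.
have := @hoelder _ _ _ mu _ _ 2 2 mf mg.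
rewrite Lnorm1 => /(_ ltac:(by []) ltac:(by []) ltac:(by rewrite [RHS]splitr !div1r)) H.
rewrite !expe2 muleACA -!expe2 lee_sqr ?mule_ge0 ?Lnorm_ge0//.
exact: integral_ge0.
Qed.

(** A Schur test in which the bound [w] on the integrals over [t] returns as the weight in the
    integrals over [s]. Cauchy-Schwarz is applied to [(f * sqrt k) * sqrt k]; the support condition
    confines the weighted bound and the final integral to [D]. *)
Lemma schur_sqr d1 d2 (X : measurableType d1) (Y : measurableType d2)
    (R : realType) (m1 : {sigma_finite_measure set X -> \bar R})
    (m2 : {sigma_finite_measure set Y -> \bar R}) (k : X * Y -> R)
    (w : Y -> R) (D : set X) (c : R) (f : X -> R) :
  measurable_fun setT k -> (forall z, 0 <= k z) ->
  measurable_fun setT w -> (forall s, 0 <= w s) ->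
  measurable D -> (forall t s, ~ D t -> k (t, s) = 0) ->
  (forall s, \int[m1]_t (k (t, s))%:E <= (w s)%:E)%E -> 0 <= c ->
  (forall t, D t -> \int[m2]_s (w s * k (t, s))%:E <= c%:E)%E ->
  measurable_fun setT f ->
  (\int[m2]_s (\int[m1]_t (`|f t| * k (t, s))%:E) ^+ 2 <=
   c%:E * \int[m1]_(t in D) (f t ^+ 2)%:E)%E.
Proof.
move=> mk k0 mw w0 mD kD hw c0 hc mf.
have mkX s : measurable_fun setT (fun t => k (t, s)).
  exact: (measurableT_comp mk (pair2_measurable s)).
pose F (z : X * Y) := (w z.2 * (f z.1 ^+ 2 * k z))%:E.
have F0 z : (0 <= F z)%E by rewrite lee_fin mulr_ge0// mulr_ge0// sqr_ge0.
have mf1 : measurable_fun setT (f \o fst : X * Y -> R) by exact: measurableT_comp.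
have mF : measurable_fun setT F.
  apply/measurable_EFinP; apply: measurable_funM.
    exact: (measurableT_comp mw).
  by apply: measurable_funM => //; apply: measurable_funX.
apply: (@le_trans _ _ (\int[m2]_s \int[m1]_t F (t, s))%E).
  apply: ge0_le_integral => //.
  - by move=> s _; exact: sqre_ge0.
  - under eq_fun do rewrite expe2.
    have mG := @measurable_fun_fubini_tonelli_G _ _ X Y R m1
      (fun z => (`|f z.1| * k z)%:E).
    by apply: emeasurable_funM; apply: mG => [|z];
      rewrite ?lee_fin ?mulr_ge0//; apply/measurable_EFinP;
      apply: measurable_funM => //; exact: measurableT_comp.
  - exact: (measurable_fun_fubini_tonelli_G F).
  - move=> s _.
    have -> : (\int[m1]_t (`|f t| * k (t, s))%:E =
      \int[m1]_t `|(f t * Num.sqrt (k (t, s))) * Num.sqrt (k (t, s))|%:E)%E.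
      apply: eq_integral => t _; rewrite -mulrA -expr2 sqr_sqrtr// normrM.
      by rewrite [`|k _|]ger0_norm.
    have msk : measurable_fun setT (fun t => Num.sqrt (k (t, s))).
      apply: (measurableT_comp _ (mkX s)).
      by apply: continuous_measurable_fun; exact: sqrt_continuous.
    apply: (le_trans (cauchy_schwarz_sqr m1 (measurable_funM mf msk) msk)).
    have -> : (\int[m1]_t (Num.sqrt (k (t, s)) ^+ 2)%:E = \int[m1]_t (k (t, s))%:E)%E.
      by apply: eq_integral => t _; rewrite sqr_sqrtr.
    rewrite muleC /F/=; under [leRHS]eq_integral do rewrite EFinM.
    rewrite ge0_integralZl_EFin//; last 2 first.
    - by move=> t _; rewrite lee_fin mulr_ge0// sqr_ge0.
    - apply/measurable_EFinP; apply: measurable_funM => //.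
      exact: measurable_funX.
    have -> : (\int[m1]_t ((f t * Num.sqrt (k (t, s))) ^+ 2)%:E =
      \int[m1]_t (f t ^+ 2 * k (t, s))%:E)%E.
      by apply: eq_integral => t _; rewrite exprMn sqr_sqrtr.
    apply: lee_wpmul2r; last exact: hw.
    by apply: integral_ge0 => t _; rewrite lee_fin mulr_ge0// sqr_ge0.
rewrite -fubini_tonelli// -ge0_integralZl_EFin//; last 2 first.
- by move=> t _; rewrite lee_fin sqr_ge0.
- by apply/measurable_EFinP; apply: measurable_funX; apply: measurable_funTS.
rewrite [leRHS]integral_mkcond; apply: ge0_le_integral => //.
- by move=> t _; exact: integral_ge0.
- exact: (measurable_fun_fubini_tonelli_F F).
- apply/(measurable_restrictT _ mD); apply: measurable_funTS.
  apply/measurable_EFinP; apply: measurable_funM => //; exact: measurable_funX.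
move=> t _; rewrite /patch; case: ifPn => [/set_mem Dt|/negP Dt]; last first.
  rewrite integral0_eq// => s _; rewrite /F/= kD ?mulr0//.
  by move=> Dt'; apply: Dt; exact: mem_set.
rewrite -EFinM mulrC EFinM.
have -> : (\int[m2]_s F (t, s) =
    \int[m2]_s ((f t ^+ 2)%:E * (w s * k (t, s))%:E))%E.
  by apply: eq_integral => s _; rewrite -EFinM /F/= mulrCA.
rewrite ge0_integralZl_EFin ?sqr_ge0//.
- by apply: lee_wpmul2l; [rewrite lee_fin sqr_ge0|exact: hc].
- by move=> s _; rewrite lee_fin mulr_ge0.
- apply/measurable_EFinP; apply: measurable_funM => //.
  exact: (measurableT_comp mk (pair1_measurable t)).
Qed.

(** * Open sets and continuous functions in the plane *)

Section ProductMeasurability.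
Context {R : realType}.
Local Notation mR := (measurableTypeR R).

(** Second countability links the topology of the plane to the product sigma-algebra: an open set is
    the union of the rational boxes that it contains. *)
Lemma open_measurable_prod (O : set (R * R)) : open O ->
  measurable (O : set (mR * mR)).
Proof.
move=> oO.
pose box (q : rat * rat * (rat * rat)) : set (R * R) :=
  `]ratr q.1.1, ratr q.1.2[%classic `*` `]ratr q.2.1, ratr q.2.2[%classic.
pose B n := if @unpickle (rat * rat * (rat * rat))%type n is Some q then
  (if `[< box q `<=` O >] then box q else set0) else set0.
have -> : O = \bigcup_n B n.
  apply/seteqP; split => [x Ox|x [n _]]; last first.
    by rewrite /B; case: unpickle => // q; case: asboolP => // qO; exact: qO.
  have [e /= e0 xO] : nbhs_ball x O by apply/nbhs_ballP; exact: open_nbhs_nbhs.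
  have rat_near (r : R) : exists a b : rat,
      (ratr a \in `]r - e, r[) /\ (ratr b \in `]r, r + e[).
    have [a ar] := @rat_in_itvoo _ (r - e) r ltac:(by rewrite ltrBlDr ltrDl).
    have [b br] := @rat_in_itvoo _ r (r + e) ltac:(by rewrite ltrDl).
    by exists a, b.
  have [a [b []]] := rat_near x.1; have [c [d []]] := rat_near x.2.
  rewrite !in_itv/= => /andP[c1 c2] /andP[d1 d2] /andP[a1 a2] /andP[b1 b2].
  exists (pickle ((a, b), (c, d))); first exact: I.
  rewrite /B pickleK ifT; first by split; rewrite /= in_itv/= ?a2 ?c2.
  apply/asboolP => y [/=]; rewrite !in_itv/= => /andP[ay yb] /andP[cy yd].
  apply: xO; split; rewrite /ball/= ltr_norml; apply/andP; split; lra.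
apply: bigcup_measurable => n _; rewrite /B; case: unpickle => [q|]; last exact: measurable0.
case: asboolP => _; last exact: measurable0.
by apply: measurableX; exact: measurable_itv.
Qed.

Lemma continuous_measurable_prod (g : R * R -> R) : continuous g ->
  measurable_fun [set: mR * mR] g.
Proof.
move=> /continuousP cg; apply: (measurability _ (RGenOpens.measurableE R)).
move=> _ [_ [a [b ->] <-]]; rewrite setTI; apply: open_measurable_prod.
exact/cg/interval_open.
Qed.

Lemma within_continuous_comp (S : set (R * R)) (g : R * R -> R) (h : R * R -> R * R) :
  {within S, continuous g} -> continuous h -> (forall z, S (h z)) ->
  continuous (g \o h).
Proof.
move=> /subspace_continuousP cg ch hS z.
have gz := cg _ (hS z).
apply: (@cvg_comp _ _ _ h g _ (within S (nbhs (h z)))) => //.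
move=> A hA.
have hSA : nbhs z (h @^-1` [set y | S y -> A y]) by exact: (ch z _ hA).
change (nbhs z (h @^-1` A)); apply: filterS hSA => y yA; exact: yA (hS y).
Qed.
End ProductMeasurability.

(** * Lebesgue measure restricted to []0, T[] and its square norm *)

Section LebesgueOn.
Context {R : realType} (T : R).
Local Notation mR := (measurableTypeR R).
Local Notation lambda := (@lebesgue_measure R).

Lemma lebesgue_onE (A : set mR) : lebesgue_on T A = lambda (A `&` `]0, T[).
Proof. by []. Qed.

Lemma integral_lebesgue_on (g : mR -> \bar R) : measurable_fun setT g ->
  (forall x, 0 <= g x)%E ->
  (\int[lebesgue_on T]_x g x = \int[lambda]_(x in `]0%R, T[) g x)%E.
Proof.
move=> mg g0.
have mD : measurable (`]0, T[%classic : set mR) by exact: measurable_itv.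
rewrite (@ge0_negligible_integral _ _ _ (lebesgue_on T) setT (~` `]0, T[)%classic)//.
- rewrite setTD setCK; apply: eq_measure_integral => A mA AD.
  by rewrite lebesgue_onE setIidl.
- exact: measurableC.
- by rewrite lebesgue_onE setICl measure0.
Qed.

Lemma ae_lebesgue_on (P : mR -> Prop) : {ae lambda, forall s, s \in `]0, T[ -> P s} ->
  {ae lebesgue_on T, forall s, P s}.
Proof.
move=> [N [mN N0 PN]].
have mD : measurable (`]0, T[%classic : set mR) by exact: measurable_itv.
exists (N `|` ~` `]0, T[%classic); split.
- by apply: measurableU => //; exact: measurableC.
- rewrite lebesgue_onE setIUl setICl setU0; apply/eqP; rewrite -measure_le0 -N0.
  by apply: le_measure; rewrite ?inE//; exact: measurableI.
- move=> s /= nPs; have [sD|sD] := pselect (s \in `]0, T[); last by right.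
  by left; apply: PN => /= /(_ sD).
Qed.

Lemma ae_lebesgue_onP (P : mR -> Prop) : {ae lebesgue_on T, forall s, P s} ->
  {ae lambda, forall s, s \in `]0, T[ -> P s}.
Proof.
move=> [N [mN N0 PN]].
have mD : measurable (`]0, T[%classic : set mR) by exact: measurable_itv.
exists (N `&` `]0, T[%classic); split => //; first exact: measurableI.
by move=> s /= /not_implyP[sD nPs]; split => //; exact: PN.
Qed.

Lemma Lnorm2_le (g h : mR -> R) (c : R) : measurable_fun setT g ->
  measurable_fun setT h -> 0 <= c ->
  (\int[lambda]_(x in `]0%R, T[) (g x ^+ 2)%:E <=
   (c ^+ 2)%:E * \int[lambda]_(x in `]0%R, T[) (h x ^+ 2)%:E)%E ->
  ('N[lebesgue_on T]_2%:E[EFin \o g] <= c%:E * 'N[lebesgue_on T]_2%:E[EFin \o h])%E.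
Proof.
move=> mg mh c0 gh.
rewrite -lee_sqr ?mule_ge0 ?Lnorm_ge0// expe2 [leRHS]expe2 muleACA -!expe2.
rewrite !Lnorm2_sqr -EFin_expe !integral_lebesgue_on//.
- by apply/measurable_EFinP; exact: measurable_funX.
- by move=> x; rewrite lee_fin sqr_ge0.
- by apply/measurable_EFinP; exact: measurable_funX.
- by move=> x; rewrite lee_fin sqr_ge0.
Qed.

Lemma L2norm_sqr (f : L2 T) :
  (L2norm f ^+ 2 = \int[lambda]_(x in `]0%R, T[) (f x ^+ 2)%:E)%E.
Proof.
rewrite /L2norm Lnorm2_sqr integral_lebesgue_on//.
- by apply/measurable_EFinP; exact: measurable_funX.
- by move=> x; rewrite lee_fin sqr_ge0.
Qed.

Lemma L2norm_lty (f : L2 T) : (L2norm f < +oo)%E.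
Proof. exact: Lfunction_finite. Qed.

End LebesgueOn.

(** * The kernel of (c), its derivative and the integral operator *)

Section VolterraKernel.
Context {R : realType} (T : R) (K : R -> R -> R).
Local Notation mR := (measurableTypeR R).
Local Notation lambda := (@lebesgue_measure R).
Hypothesis T0 : 0 < T.
Hypothesis K_above : forall t s, t \in `[0, T] -> s \in `[0, T] -> t < s -> K t s = 0.
Hypothesis K_continuous : {within [set z : R * R | 0 <= z.2 /\ z.2 <= z.1 /\ z.1 <= T],
  continuous (fun z => K z.1 z.2)}.
Hypothesis K_ge0 : forall t s, 0 <= s -> s <= t -> t <= T -> 0 <= K t s.
Hypothesis K_monotone : forall s, s \in `[0, T] ->
  {in `[0, T] &, nondecreasing_fun (K^~ s)} \/
  {in `[0, T] &, nonincreasing_fun (K^~ s)}.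
Hypothesis K_derivable : forall t s, 0 < s -> s < t -> t < T -> derivable (K^~ s) t 1.

(* [K] composed with a retraction of the plane onto the triangle: it is jointly
   continuous, whereas [K] itself may jump across the diagonal. *)
Definition kernel_ext (t s : R) := K (clamp (clamp 0 T s) T t) (clamp 0 T s).

(** Extension by zero off the open triangle lets integrals in either variable run over the whole
    line, ready for Tonelli. *)
Definition kernel_deriv (z : R * R) : R :=
  if [&& 0 < z.2, z.2 < z.1 & z.1 < T] then derive1 (K^~ z.2) z.1 else 0.

Lemma kernel_ext_continuous : continuous (fun z : R * R => kernel_ext z.1 z.2).
Proof.
pose h (z : R * R) := (clamp (clamp 0 T z.2) T z.1, clamp 0 T z.2).
have ch2 : continuous (fun z : R * R => clamp 0 T z.2).
  by move=> z; apply: continuous_comp; [exact: cvg_snd|exact: continuous_clamp].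
apply: (within_continuous_comp (h := h) K_continuous).
  have ch1 : continuous (fun z : R * R => clamp (clamp 0 T z.2) T z.1).
    move=> z; apply: (@continuous_max _ _ (fun z : R * R => clamp 0 T z.2) (fun z => Num.min z.1 T)).
      exact: ch2.
    apply: (@continuous_min _ _ fst (cst T)); first exact: cvg_fst.
    exact: cst_continuous.
  by move=> z; exact: (cvg_pair (ch1 z) (ch2 z)).
move=> z /=; have := clamp_in z.2 (ltW T0); rewrite in_itv/= => /andP[s0 sT].
by have := clamp_in z.1 sT; rewrite in_itv/= => /andP[].
Qed.

Lemma kernel_ext_continuous1 s : continuous (kernel_ext ^~ s).
Proof.
move=> t; apply: (@continuous_comp _ _ _ (fun t => (t, s)) (fun z => kernel_ext z.1 z.2)).
  exact: (cvg_pair (@cvg_id _ (nbhs t)) (@cvg_cst _ s _ (nbhs t) _)).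
exact: kernel_ext_continuous.
Qed.

Lemma kernel_extE t s : 0 <= s -> s <= t -> t <= T -> kernel_ext t s = K t s.
Proof.
move=> s0 st tT; have sT := le_trans st tT.
by rewrite /kernel_ext [clamp 0 T s]clampE ?clampE// in_itv/= ?s0 ?st.
Qed.

(** Since [K 0 s = 0] for [0 < s], a nonincreasing and non-negative section is identically zero,
    hence nondecreasing as well. *)
Lemma kernel_nondecreasing s : 0 < s -> s <= T -> {in `[0, T] &, nondecreasing_fun (K^~ s)}.
Proof.
move=> s0 sT; have sin : s \in `[0, T] by rewrite in_itv/= ltW.
have [//|dec] := K_monotone sin.
have in0 : 0 \in `[0, T] by rewrite in_itv/= lexx ltW.
have Kzero t : t \in `[0, T] -> K t s = 0.
  move=> tin; have [ts|st] := ltP t s; first exact: K_above.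
  move: (tin); rewrite in_itv/= => /andP[t0 tT].
  by apply/eqP; rewrite eq_le K_ge0 ?(ltW s0)// andbT -(K_above in0 sin s0) dec.
by move=> x y xin yin _ /=; rewrite !Kzero.
Qed.

Lemma kernel_ext_nondecreasing s : 0 < s -> s < T -> {homo kernel_ext^~ s : x y / x <= y}.
Proof.
move=> s0 sT x y xy.
have sin : s \in `[0, T] by rewrite in_itv/= !ltW.
rewrite /kernel_ext [clamp 0 T s]clampE//.
have inT t : clamp s T t \in `[0, T].
  have := clamp_in t (ltW sT); rewrite !in_itv/= => /andP[+ ->].
  by move=> /(le_trans (ltW s0)) ->.
by apply: (kernel_nondecreasing s0 (ltW sT)); rewrite ?inT// clamp_le.
Qed.

Lemma kernel_ext_is_derive t s : 0 < s -> s < t -> t < T ->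
  is_derive t 1 (kernel_ext^~ s) (kernel_deriv (t, s)).
Proof.
move=> s0 st tT; rewrite /kernel_deriv/= s0 st tT /=.
have tnear : \near t, K^~ s t = kernel_ext^~ s t.
  near=> u; rewrite kernel_extE ?(ltW s0)//.
    by apply: ltW; near: u; exact: lt_nbhsr.
  by apply: ltW; near: u; exact: lt_nbhsl.
apply: (near_eq_is_derive tnear); rewrite derive1E.
exact/derivableP/K_derivable.
Unshelve. all: by end_near. Qed.

(** Countably many difference quotients suffice for the sign and the joint measurability of the
    derivative. With [kernel_ext] they remain continuous in both variables even where
    [t + n.+1%:R^-1] exceeds [T]. *)
Lemma kernel_deriv_cvg t s : 0 < s -> s < t -> t < T ->
  n.+1%:R * (kernel_ext (t + n.+1%:R^-1) s - kernel_ext t s) @[n --> \oo]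
    --> kernel_deriv (t, s).
Proof.
move=> s0 st tT; have [df <-] := kernel_ext_is_derive s0 st tT.
move: df => /cvgrPdist_le df; apply/cvgrPdist_le => e /df[d /= d0 dP].
near=> n.
have hn0 : 0 < n.+1%:R^-1 :> R by rewrite invr_gt0.
have hd : n.+1%:R^-1 < d by near: n; exact: (near_infty_natSinv_lt (PosNum d0)).
have := dP n.+1%:R^-1; rewrite /= sub0r normrN gtr0_norm//.
move=> /(_ hd (lt0r_neq0 hn0)).
by rewrite -[_%:A]/(_ * _) mulr1 -[_ *: _]/(_ * _) invrK [_ + t]addrC.
Unshelve. all: by end_near. Qed.

Lemma kernel_deriv_ge0 z : 0 <= kernel_deriv z.
Proof.
case: z => t s; rewrite /kernel_deriv/=.
have [/and3P[s0 st tT]|//] := boolP [&& _, _ & _].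
have := kernel_deriv_cvg s0 st tT; rewrite /kernel_deriv/= s0 st tT/= => /cvgr_to_ge.
apply; apply: nearW => n; rewrite mulr_ge0// subr_ge0.
by apply: kernel_ext_nondecreasing => //; [exact: lt_trans tT|rewrite lerDl].
Qed.

Let triangle : set (mR * mR) := [set z | [&& 0 < z.2, z.2 < z.1 & z.1 < T]].

Lemma measurable_kernel_deriv : measurable_fun [set: mR * mR] kernel_deriv.
Proof.
have m1 : measurable_fun [set: mR * mR] (fst : _ -> R) by exact: measurable_fst.
have m2 : measurable_fun [set: mR * mR] (snd : _ -> R) by exact: measurable_snd.
have mtri : measurable triangle.
  have mb : measurable_fun setT (fun z : mR * mR => [&& 0 < (z.2 : R), (z.2 : R) < z.1 & (z.1 : R) < T]).
    apply: measurable_and; first exact: measurable_fun_ltr.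
    by apply: measurable_and; exact: measurable_fun_ltr.
  by have := mb measurableT [set true]; rewrite setTI; apply.
have kE : kernel_deriv = (fun z => derive1 (K^~ z.2) z.1) \_ triangle.
  apply/funext => z; rewrite /kernel_deriv /patch.
  have -> // : (z \in triangle) = [&& 0 < z.2, z.2 < z.1 & z.1 < T].
  by apply/idP/idP => [/set_mem|/mem_set].
rewrite kE; apply/(measurable_restrictT _ mtri).
pose D n (z : R * R) := n.+1%:R * (kernel_ext (z.1 + n.+1%:R^-1) z.2 - kernel_ext z.1 z.2).
apply: (@measurable_fun_cvg _ _ _ _ D).
  move=> n; apply: measurable_funTS; apply: continuous_measurable_prod => z.
  apply: cvgM; first exact: cvg_cst.
  apply: cvgB; last exact: kernel_ext_continuous.
  have ch : continuous (fun z : R * R => (z.1 + n.+1%:R^-1, z.2)).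
    have ch1 : continuous (fun z : R * R => z.1 + n.+1%:R^-1).
      by move=> w; apply: cvgD; [exact: cvg_fst|exact: cvg_cst].
    have ch2 : continuous (snd : R * R -> R) by move=> w; exact: cvg_snd.
    by move=> w; exact: (cvg_pair (ch1 w) (ch2 w)).
  apply: (@continuous_comp _ _ _ (fun z : R * R => (z.1 + n.+1%:R^-1, z.2))
    (fun z => kernel_ext z.1 z.2)); first exact: ch.
  exact: kernel_ext_continuous.
move=> [t s] /and3P[/= s0 st tT]; have := kernel_deriv_cvg s0 st tT.
by rewrite /kernel_deriv/= s0 st tT.
Qed.

Lemma kernel_ext_cumulative s : 0 < s -> s < T -> is_cumulative (kernel_ext^~ s).
Proof.
move=> s0 sT; split; first exact: kernel_ext_nondecreasing.
by apply: right_continuousW => x; exact: kernel_ext_continuous1.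
Qed.

(** The density theorem gives the Stieltjes mass of the open interval, where the derivative exists;
    continuity of the kernel at [v] shows that the right endpoint carries no mass. *)
Lemma integral_kernel_deriv s u v : 0 < s -> s < T -> s <= u -> u <= v -> v <= T ->
  (\int[lambda]_(t in `]u, v]) (kernel_deriv (t, s))%:E =
   (kernel_ext v s - kernel_ext u s)%:E)%E.
Proof.
move=> s0 sT su uv vT.
have mk : measurable_fun setT (fun t => kernel_deriv (t, s)).
  exact: (measurableT_comp measurable_kernel_deriv (pair2_measurable s)).
rewrite -integral_itv_bndo_bndc; last exact/measurable_funTS/measurable_EFinP.
pose F := to_cumulative (kernel_ext^~ s).
have FE : F = kernel_ext^~ s :> (R -> R) by exact/to_cumulativeE/kernel_ext_cumulative.
pose mu : {measure set mR -> \bar R} := lebesgue_stieltjes_measure F.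
have <- : mu `]u, v[%classic = (\int[lambda]_(t in `]u, v[) (kernel_deriv (t, s))%:E)%E.
  apply: stieltjes_density.
  - exact: measurable_itv.
  - by rewrite lebesgue_measure_itv/=; case: ifP => _; rewrite ?ltry.
  - exact: measurable_funTS.
  - by move=> t _; exact: kernel_deriv_ge0.
  - move=> t /=; rewrite in_itv/= => /andP[ut tv]; rewrite FE.
    by apply: kernel_ext_is_derive => //; [exact: le_lt_trans ut|exact: lt_le_trans vT].
have muE x y : x <= y -> mu `]x, y]%classic = (kernel_ext y s - kernel_ext x s)%:E.
  by move=> xy; rewrite -[kernel_ext y s]/((kernel_ext^~ s) y) -[kernel_ext x s]/((kernel_ext^~ s) x) -FE; exact: stieltjes_itv_oc.
have mu_le : (mu `]u, v[%classic <= (kernel_ext v s - kernel_ext u s)%:E)%E.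
  rewrite -muE//; apply: le_measure; rewrite ?inE//.
  by apply: subset_itvl; rewrite bnd_simp.
apply/eqP; rewrite eq_le mu_le/=.
have /predU1P[<-|ltuv] : (u == v) || (u < v) by rewrite -le_eqVlt.
  by rewrite subrr.
have mu_fin : mu `]u, v[%classic \is a fin_num.
  by rewrite ge0_fin_numE//; apply: le_lt_trans mu_le _; exact: ltry.
rewrite -(fineK mu_fin) lee_fin lerBlDr.
have Fv : kernel_ext x s @[x --> v^'-] --> kernel_ext v s.
  by apply: cvg_within_filter; exact: kernel_ext_continuous1.
apply: (cvgr_to_le Fv); near=> x.
have ux : u < x by near: x; exact: nbhs_left_gt.
have xv : x < v by near: x; exact: nbhs_left_lt.
rewrite -lerBlDr -lee_fin fineK// -muE ?(ltW ux)//.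
apply: le_measure; rewrite ?inE//.
by apply: subset_itvl; rewrite bnd_simp.
Unshelve. all: by end_near. Qed.

Let measurable_kernel_deriv1 s : measurable_fun [set: mR] (fun t => kernel_deriv (t, s)).
Proof. exact: (measurableT_comp measurable_kernel_deriv (pair2_measurable s)). Qed.

Let measurable_kernel_deriv1E s :
  measurable_fun [set: mR] (fun t => (kernel_deriv (t, s))%:E).
Proof. by apply/measurable_EFinP. Qed.

Lemma kernel_deriv0 t s : ~~ [&& 0 < s, s < t & t < T] -> kernel_deriv (t, s) = 0.
Proof. by move=> /negbTE st; rewrite /kernel_deriv st. Qed.

Lemma kernel_ext_ge0 t s : 0 <= kernel_ext t s.
Proof.
have := clamp_in s (ltW T0); rewrite in_itv/= => /andP[s0 sT].
by have := clamp_in t sT; rewrite in_itv/= => /andP[st tT]; exact: K_ge0.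
Qed.

(** For [0 < s < T] the integral is [K T s - K s s], and the diagonal term is non-negative. This
    makes [kernel_ext T] the weight in the Schur test, matching the weight in the third hypothesis
    of (c). *)
Lemma integral_kernel_deriv_le s :
  (\int[lambda]_t (kernel_deriv (t, s))%:E <= (kernel_ext T s)%:E)%E.
Proof.
have [/andP[s0 sT]|sD] := boolP ((0 < s) && (s < T)); last first.
  rewrite integral0_eq ?lee_fin ?kernel_ext_ge0// => t _.
  rewrite kernel_deriv0//; apply: contra sD => /and3P[-> st tT].
  exact: lt_trans tT.
have -> : (\int[lambda]_t (kernel_deriv (t, s))%:E =
    \int[lambda]_(t in `]s, T]) (kernel_deriv (t, s))%:E)%E.
  rewrite [RHS]integral_mkcond; apply: eq_integral => t _; rewrite /patch.
  case: ifPn => // /negP tn; rewrite kernel_deriv0//.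
  apply/negP => /and3P[_ st tT]; apply: tn.
  by apply: mem_set; rewrite /= in_itv/= st ltW.
rewrite integral_kernel_deriv ?(ltW sT)// lee_fin gerBl.
exact: kernel_ext_ge0.
Qed.

Lemma integral_kernel_deriv_weight (c : R) t : t \in `]0, T[ ->
  (\int[lambda]_(s in `]0%R, t[) (K T s * `|derive1 (K^~ s) t|)%:E <= c%:E)%E ->
  (\int[lambda]_s (kernel_ext T s * kernel_deriv (t, s))%:E <= c%:E)%E.
Proof.
rewrite in_itv/= => /andP[t0 tT]; congr (_ <= _)%E.
rewrite integral_mkcond; apply: eq_integral => s0 _; move: s0.
suff ptE (s : R) : ((fun s => (K T s * `|derive1 (K^~ s) t|)%:E) \_ `]0, t[) s =
    (kernel_ext T s * kernel_deriv (t, s))%:E by exact: ptE.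
rewrite /patch; case: ifPn => [/set_mem/=|/negP sn].
  rewrite in_itv/= => /andP[s0 st].
  have kE : derive1 (K^~ s) t = kernel_deriv (t, s) by rewrite /kernel_deriv/= s0 st tT.
  congr (_ * _)%:E; first by have sT := lt_trans st tT; rewrite kernel_extE// ltW.
  by rewrite -[RHS]ger0_norm ?kernel_deriv_ge0//; congr (`|_|); exact: kE.
rewrite kernel_deriv0 ?mulr0//; apply/negP => /and3P[s0 st _]; apply: sn.
by apply: mem_set; rewrite /= in_itv/= s0.
Qed.

Let measurable_kernel_ext2 t : measurable_fun [set: mR] (kernel_ext t).
Proof.
have mK := continuous_measurable_prod kernel_ext_continuous.
exact: (measurableT_comp mK (pair1_measurable t)).
Qed.

Definition volterra (f : R -> R) (s : R) : R :=
  \int[lambda]_t (f t * kernel_deriv (t, s)).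

(** An extended-real majorant: its finiteness at [s] is what makes the real-valued [volterra] a
    genuine integral there. *)
Definition volterra_abs (f : R -> R) (s : R) : \bar R :=
  (\int[lambda]_t (`|f t| * kernel_deriv (t, s))%:E)%E.

Lemma volterra_abs_ge0 f s : (0 <= volterra_abs f s)%E.
Proof. by apply: integral_ge0 => t _; rewrite lee_fin mulr_ge0// kernel_deriv_ge0. Qed.

(** No joint integrability is known here, so measurability is obtained from Tonelli applied
    separately to the positive and negative parts. *)
Lemma measurable_volterra f : measurable_fun [set: mR] f ->
  measurable_fun [set: mR] (volterra f).
Proof.
move=> mf; pose F (z : mR * mR) := (f z.1 * kernel_deriv z)%:E.
have mF : measurable_fun setT F.
  apply/measurable_EFinP; apply: measurable_funM.
    exact: (measurableT_comp mf measurable_fst).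
  exact: measurable_kernel_deriv.
have -> : volterra f = fine \o (fun s =>
    \int[lambda]_t F^\+ (t, s) - \int[lambda]_t F^\- (t, s))%E.
  apply/funext => s; rewrite /volterra /Rintegral integralE/=.
  by congr (fine (_ - _)%E); apply: eq_integral => t _; rewrite !unlock.
apply: (measurableT_comp (@fine_measurable R setT measurableT)).
apply: emeasurable_funB.
  apply: (measurable_fun_fubini_tonelli_G (fun z => F^\+ z)%E) => //.
  exact: measurable_funepos.
apply: (measurable_fun_fubini_tonelli_G (fun z => F^\- z)%E) => //.
exact: measurable_funeneg.
Qed.

Lemma measurable_volterra_abs f : measurable_fun [set: mR] f ->
  measurable_fun [set: mR] (volterra_abs f).
Proof.
move=> mf.
apply: (measurable_fun_fubini_tonelli_G (fun z : mR * mR => (`|f z.1| * kernel_deriv z)%:E)).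
  apply/measurable_EFinP; apply: measurable_funM; last exact: measurable_kernel_deriv.
  by apply: measurableT_comp => //; exact: (measurableT_comp mf measurable_fst).
by move=> z; rewrite lee_fin mulr_ge0// kernel_deriv_ge0.
Qed.

Let measurable_integrand (f : R -> R) s : measurable_fun [set: mR] f ->
  measurable_fun [set: mR] (fun t => (f t * kernel_deriv (t, s))%:E).
Proof.
by move=> mf; apply/measurable_EFinP; apply: measurable_funM => //.
Qed.

Lemma volterra_le f s : measurable_fun [set: mR] f ->
  (`|volterra f s|%:E <= volterra_abs f s)%E.
Proof.
move=> mf; apply: (@le_trans _ _ `|\int[lambda]_t (f t * kernel_deriv (t, s))%:E|%E).
  (* An infinite integral is sent to 0 by [fine], and the bound persists. *)
  rewrite /volterra /Rintegral; by case: (integral _ _ _) => [r||] //=; rewrite leey.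
apply: (le_trans (le_abse_integral _ _ _)) => //; first exact: measurable_integrand.
rewrite le_eqVlt; apply/orP; left; apply/eqP; apply: eq_integral => t _ /=.
by rewrite normrM (ger0_norm (kernel_deriv_ge0 _)).
Qed.

Lemma volterra_abs_sqr (K1 : R) (f : R -> R) : 
  (forall t, t \in `]0, T[ ->
    (\int[lambda]_(s in `]0%R, t[) (K T s * `|derive1 (K^~ s) t|)%:E <= (K1 ^+ 2)%:E)%E) ->
  measurable_fun [set: mR] f ->
  (\int[lambda]_s (volterra_abs f s) ^+ 2 <=
   (K1 ^+ 2)%:E * \int[lambda]_(t in `]0%R, T[) (f t ^+ 2)%:E)%E.
Proof.
move=> hK1 mf; apply: (@schur_sqr _ _ mR mR R lambda lambda kernel_deriv (kernel_ext T)
    `]0, T[%classic (K1 ^+ 2) f) => //.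
- exact: measurable_kernel_deriv.
- exact: kernel_deriv_ge0.
- by move=> s; exact: kernel_ext_ge0.
- move=> t s tD; apply: kernel_deriv0; apply/negP => /and3P[s0 st tT]; apply: tD.
  by rewrite /= in_itv/= tT (lt_trans s0 st).
- exact: integral_kernel_deriv_le.
- exact: sqr_ge0.
- by move=> t tD; apply: integral_kernel_deriv_weight => //; exact: hK1.
Qed.

Lemma volterra_eq (f g : R -> R) s : measurable_fun [set: mR] f -> measurable_fun [set: mR] g ->
  {ae lambda, forall t, t \in `]0, T[ -> f t = g t} -> volterra f s = volterra g s.
Proof.
move=> mf mg fg; congr fine.
apply: ae_eq_integral => //; try exact: measurable_integrand.
move: fg => [N [mN N0 fgN]]; exists N; split => // t /= /not_implyP[_ ne].
apply: fgN => /= fgt; apply: ne.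
have [/and3P[s0 st tT]|nst] := boolP [&& 0 < s, s < t & t < T].
  by rewrite fgt// in_itv/= tT (lt_trans s0).
by rewrite kernel_deriv0// !mulr0.
Qed.

Lemma volterra_linear (a : R) (f g : R -> R) s :
  measurable_fun [set: mR] f -> measurable_fun [set: mR] g ->
  (volterra_abs f s < +oo)%E -> (volterra_abs g s < +oo)%E ->
  volterra (fun t => a * f t + g t) s = a * volterra f s + volterra g s.
Proof.
move=> mf mg foo goo.
have int (h : R -> R) : measurable_fun [set: mR] h -> (volterra_abs h s < +oo)%E ->
    lambda.-integrable setT (EFin \o (fun t => h t * kernel_deriv (t, s))).
  move=> mh hoo; apply/integrableP; split; first exact: measurable_integrand.
  apply: le_lt_trans hoo; rewrite le_eqVlt; apply/orP; left; apply/eqP.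
  apply: eq_integral => t _ /=.
  by rewrite normrM (ger0_norm (kernel_deriv_ge0 _)).
rewrite /volterra -RintegralZl//; last exact: int.
rewrite -RintegralD//; last 2 first.
- by apply: integrable_mull => //; exact: int.
- exact: int.
by apply: eq_Rintegral => t _; rewrite mulrDl mulrA.
Qed.

(** The formula of (c) with K(s+, s) read off the continuous extension and the Stieltjes measure
    replaced by its density. *)
Definition kstar_fun (f : R -> R) (s : R) : R := kernel_ext s s * f s + volterra f s.

Let measurable_kernel_ext_diag : measurable_fun [set: mR] (fun s => kernel_ext s s).
Proof.
have mK := continuous_measurable_prod kernel_ext_continuous.
have mdiag : measurable_fun [set: mR] (fun s : mR => (s, s)).
  exact: measurable_fun_pair.
exact: (measurableT_comp mK mdiag).
Qed.

Lemma measurable_kstar_fun f : measurable_fun [set: mR] f ->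
  measurable_fun [set: mR] (kstar_fun f).
Proof.
move=> mf; apply: measurable_funD; last exact: measurable_volterra.
exact: measurable_funM.
Qed.

Lemma kstar_fun_formula (f g : R -> R) s : {within `[0, T], continuous f} ->
  (forall t, t \in `]0, T[ -> g t = f t) -> s \in `]0, T[ ->
  kstar_fun g s = kstar_formula T K f s.
Proof.
move=> cf gf sD; move: (sD); rewrite in_itv/= => /andP[s0 sT].
have sT' := ltW sT.
(* Both sides are limits of the Stieltjes sums of [K^~ s]: the formula by
   (b), [kstar_fun] because [kernel_deriv] is the density of its measure. *)
apply: (rs_limit_unique (f := f) (g := K^~ s) T0); last first.
  apply: rs_limit_bounded_variation => //.
    by apply: nondecreasing_bounded_variation => //; exact: kernel_nondecreasing.
  move=> t t0 ts; apply: K_above => //; first by rewrite in_itv/= t0 ltW// (lt_trans ts).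
  by rewrite in_itv/= !ltW.
have cfs : {within `[s, T], continuous f}.
  apply: continuous_subspaceW cf => x /=; rewrite !in_itv/= => /andP[+ ->].
  by move/(le_trans (ltW s0)) ->.
(* [f] and [g] may differ at [T], where [kernel_deriv] vanishes. *)
have volE : volterra g s =
    \int[lambda]_(t in `]s, T]) (f t * kernel_deriv (t, s)).
  rewrite Rintegral_mkcond; congr fine; apply: eq_integral => t' _; congr EFin; move: t'.
  suff ptE (t : R) : g t * kernel_deriv (t, s) =
      ((fun t => f t * kernel_deriv (t, s)) \_ `]s, T]) t by exact: ptE.
  rewrite /patch; case: ifPn => [/set_mem/=|/negP tn].
    rewrite in_itv/= => /andP[st]; rewrite le_eqVlt => /predU1P[->|tT].
      by rewrite kernel_deriv0 ?mulr0// ltxx !andbF.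
    by rewrite gf// in_itv/= tT (lt_trans s0).
  rewrite kernel_deriv0 ?mulr0//; apply/negP => /and3P[_ st tT]; apply: tn.
  by apply: mem_set; rewrite /= in_itv/= st ltW.
have prim : rs_primitive s T f (kernel_ext^~ s)
    (fun v => \int[lambda]_(t in `]s, v]) (f t * kernel_deriv (t, s))).
  have sub_cc : `]s, T] `<=` `[s, T].
    by move=> x /=; rewrite !in_itv/= => /andP[/ltW -> ->].
  apply: rs_primitive_integral.
  - by apply: measurable_funS (continuous_measurable_itv cfs).
  - have [M fM] := continuous_bounded_itv cfs.
    by exists M => x /sub_cc; exact: fM.
  - apply/integrableP; split.
      exact: measurable_funTS (measurable_kernel_deriv1E s).
    apply: (@le_lt_trans _ _ (\int[lambda]_(t in `]s, T]) (kernel_deriv (t, s))%:E)%E).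
      rewrite le_eqVlt; apply/orP; left; apply/eqP; apply: eq_integral => t _ /=.
      by rewrite (ger0_norm (kernel_deriv_ge0 _)).
    by rewrite integral_kernel_deriv// ltry.
  - by move=> t _; exact: kernel_deriv_ge0.
  - by move=> u v su uv vT; rewrite /Rintegral integral_kernel_deriv.
have := rs_primitive_clamp (a' := 0) (b' := T) sT' prim.
have mono : (kernel_ext^~ s \o clamp s T) 0 <= (kernel_ext^~ s \o clamp s T) T.
  by apply: kernel_ext_nondecreasing => //; apply: clamp_le; exact: ltW.
move=> /(rs_limit_primitive T0 cf)/(_ mono).
rewrite /= [clamp s T T]clampE ?in_itv/= ?lexx ?sT'//.
have -> : clamp s T 0 = s by rewrite /clamp (min_idPl (ltW T0)) (max_idPl (ltW s0)).
rewrite set_itvoc0 Rintegral_set0 subr0 -volE => volP.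
(* The clamped kernel equals [K s s] to the left of [s]; the jump term with the same coefficient
   cancels it there, which restores [K t s = 0]. *)
have := rs_limitD (rs_limitZ (K s s) (rs_limit_jump s0 sT cf)) volP.
rewrite /kstar_fun kernel_extE// ?ltW// gf//.
apply: rs_limit_ext => t; rewrite in_itv/= => /andP[t0 tT] /=.
rewrite -[_ *: _]/(_ * _).
have [st|ts] := leP s t.
  by rewrite subrr mulr0 add0r clampE ?in_itv/= ?st// (kernel_extE (ltW s0) st tT).
rewrite K_above// ?in_itv/= ?t0 ?s0 ?tT ?ltW//.
have -> : clamp s T t = s by rewrite /clamp (min_idPl tT) (max_idPl (ltW ts)).
by rewrite (kernel_extE (ltW s0) (lexx s) sT')/= sub0r mulrN1 addNr.
Qed.


(** * Norm bounds and the operator on [L2] *)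

Section Bounds.
Variables K0 K1 : R.
Hypothesis K_diag : forall t, t \in `]0, T[ -> K t t <= K0.
Hypothesis K1_ge0 : 0 <= K1.
Hypothesis K_schur : forall t, t \in `]0, T[ ->
  (\int[lambda]_(s in `]0%R, t[) (K T s * `|derive1 (K^~ s) t|)%:E <= (K1 ^+ 2)%:E)%E.

(** Any diagonal point would do as a witness; the midpoint is taken. *)
Lemma kernel_diag_bound_ge0 : 0 <= K0.
Proof.
have T2 : T / 2 \in `]0, T[ by rewrite in_itv/= divr_gt0//= ltr_pdivrMr// ltr_pMr// ltr1n.
apply: le_trans (K_diag T2); move: T2; rewrite in_itv/= => /andP[T20 T2T].
by apply: K_ge0 => //; exact: ltW.
Qed.

Lemma Lnorm_volterra_le f : measurable_fun [set: mR] f ->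
  ('N[lebesgue_on T]_2%:E[EFin \o volterra f] <=
   K1%:E * 'N[lebesgue_on T]_2%:E[EFin \o f])%E.
Proof.
move=> mf; apply: Lnorm2_le => //; first exact: measurable_volterra.
apply: le_trans (volterra_abs_sqr K_schur mf).
rewrite integral_mkcond; apply: ge0_le_integral => //.
- move=> s _; rewrite /patch; case: ifP => // _.
  by rewrite lee_fin sqr_ge0.
- apply/(measurable_restrictT _ (measurable_itv _)); apply: measurable_funTS.
  by apply/measurable_EFinP; apply: measurable_funX; exact: measurable_volterra.
- under eq_fun do rewrite expe2.
  by apply: emeasurable_funM; exact: measurable_volterra_abs.
- move=> s _; apply: (@le_trans _ _ (volterra f s ^+ 2)%:E).
    rewrite /patch; case: ifP => // _; by rewrite lee_fin sqr_ge0.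
  rewrite -real_normK ?num_real// EFin_expe lee_sqr ?lee_fin//.
    exact: volterra_le.
  exact: volterra_abs_ge0.
Qed.

Lemma Lnorm_diag_le (f : R -> R) : measurable_fun [set: mR] f ->
  ('N[lebesgue_on T]_2%:E[EFin \o (fun s => kernel_ext s s * f s)%R] <=
   K0%:E * 'N[lebesgue_on T]_2%:E[EFin \o f])%E.
Proof.
move=> mf; have K00 := kernel_diag_bound_ge0.
apply: Lnorm2_le => //; first exact: measurable_funM.
have mD : measurable (`]0, T[%classic : set mR) by exact: measurable_itv.
have msq : measurable_fun (`]0, T[%classic : set mR) (fun x => (f x ^+ 2)%:E).
  by apply: measurable_funTS; apply/measurable_EFinP; exact: measurable_funX.
rewrite -ge0_integralZl_EFin//; last 2 first.
- by move=> x _; rewrite lee_fin sqr_ge0.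
- exact: sqr_ge0.
apply: ge0_le_integral => //.
- by move=> x _; rewrite lee_fin sqr_ge0.
- apply: measurable_funTS; apply/measurable_EFinP; apply: measurable_funX.
  exact: measurable_funM.
- by apply: emeasurable_funM => //; exact: measurable_cst.
move=> s sD; rewrite -EFinM lee_fin exprMn ler_wpM2r ?sqr_ge0//.
have /andP[s0 sT] : 0 < s < T by move: sD; rewrite /= in_itv.
have sT' := ltW sT.
rewrite ler_sqr ?nnegrE ?kernel_ext_ge0// (kernel_extE (ltW s0) (lexx s) sT').
exact: K_diag.
Qed.

(** Minkowski's inequality adds the bound [K0] for multiplication by the diagonal to the bound [K1]
    from the Schur test. *)
Lemma Lnorm_kstar_fun_le f : measurable_fun [set: mR] f ->
  ('N[lebesgue_on T]_2%:E[EFin \o kstar_fun f] <=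
   (K0 + K1)%:E * 'N[lebesgue_on T]_2%:E[EFin \o f])%E.
Proof.
move=> mf; have K00 := kernel_diag_bound_ge0.
apply: (le_trans (minkowski_EFin (lebesgue_on T) (p := 2)
  (measurable_funM measurable_kernel_ext_diag mf) (measurable_volterra mf) _)).
  by rewrite ler1n.
rewrite [(K0 + K1)%:E]EFinD ge0_muleDl ?lee_fin//.
by apply: leeD; [exact: Lnorm_diag_le|exact: Lnorm_volterra_le].
Qed.

Lemma kstar_fun_Lfun (f : L2 T) : kstar_fun f \in Lfun (lebesgue_on T) 2%:E.
Proof.
apply/andP; split; rewrite inE/=; first exact: measurable_kstar_fun.
rewrite /finite_norm; apply: (le_lt_trans (Lnorm_kstar_fun_le _)) => //.
by rewrite lte_mul_pinfty ?lee_fin ?addr_ge0 ?kernel_diag_bound_ge0//; exact: L2norm_lty.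
Qed.

Definition kstar_L2 (f : L2 T) : L2 T := Lfun_Sub (lee1n 2) (kstar_fun_Lfun f).

(** Its square is integrable by the Schur test. This supplies the null set off which the operator is
    linear. *)
Lemma volterra_abs_lty (f : L2 T) : {ae lambda, forall s, (volterra_abs f s < +oo)%E}.
Proof.
have mf : measurable_fun [set: mR] f by exact: measurable_funP.
have int2 : lambda.-integrable setT (fun s => volterra_abs f s ^+ 2)%E.
  apply/integrableP; split.
    under eq_fun do rewrite expe2.
    by apply: emeasurable_funM; exact: measurable_volterra_abs.
  under eq_integral do rewrite gee0_abs ?sqre_ge0//.
  apply: (le_lt_trans (volterra_abs_sqr K_schur mf)).
  rewrite -L2norm_sqr lte_mul_pinfty ?lee_fin ?sqr_ge0// expe2.
  by rewrite lte_mul_pinfty ?Lnorm_ge0 ?ge0_fin_numE ?Lnorm_ge0 ?L2norm_lty.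
have := integrable_ae measurableT int2.
apply: (@filterS _ _ (ae_filter_ringOfSetsType lambda)) => s /(_ I).
by case: (volterra_abs f s) (volterra_abs_ge0 f s) => [r||]//= _; rewrite ltry.
Qed.

Lemma kstar_L2_operator : L2_operator kstar_L2.
Proof.
split=> [f g fg|a f g].
  apply: ae_lebesgue_on; have fg' := ae_lebesgue_onP fg.
  have := fg'; apply: (@filterS _ _ (ae_filter_ringOfSetsType lambda)) => s fgs sD.
  rewrite /kstar_L2/= /kstar_fun fgs//; congr (_ + _).
  by apply: volterra_eq fg'; exact: measurable_funP.
apply: ae_lebesgue_on.
apply: (@filterS2 _ _ (ae_filter_ringOfSetsType lambda) _ _ _ _
  (volterra_abs_lty f) (volterra_abs_lty g)) => s foo goo sD.
rewrite /kstar_L2/= /kstar_fun.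
have mf : measurable_fun [set: mR] f by exact: measurable_funP.
have mg : measurable_fun [set: mR] g by exact: measurable_funP.
transitivity (kernel_ext s s * (a * f s + g s) +
  volterra (fun t => a * f t + g t) s); first by [].
by rewrite (volterra_linear a mf mg foo goo); ring.
Qed.

Lemma kstar_L2_opnorm_le : (L2_opnorm kstar_L2 <= (K0 + K1)%:E)%E.
Proof.
apply: ge_ereal_sup => _ [f /= f1 <-].
have mf : measurable_fun [set: mR] f by exact: measurable_funP.
apply: (le_trans (Lnorm_kstar_fun_le mf)).
rewrite -[leRHS]mule1 lee_wpmul2l// lee_fin addr_ge0//.
exact: kernel_diag_bound_ge0.
Qed.

Lemma kstar_L2_opnorm_sqr_le : ((L2_opnorm kstar_L2) ^+ 2 <= ((K0 + K1) ^+ 2)%:E)%E.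
Proof.
rewrite EFin_expe lee_sqr ?kstar_L2_opnorm_le//; last first.
  by rewrite lee_fin addr_ge0// kernel_diag_bound_ge0.
(* Squaring requires a non-negative supremum; the zero function, which lies in the unit ball,
   provides a non-negative element. *)
apply: (@le_trans _ _ (L2norm (kstar_L2 0))); first exact: Lnorm_ge0.
apply: ereal_sup_ubound; exists 0 => //=.
by rewrite /L2norm (_ : _ \o _ = cst 0%E) ?Lnorm0.
Qed.

Lemma kstar_L2_extends : L2_extends (kstar_formula T K) kstar_L2.
Proof.
move=> f cf g gf; apply: ae_lebesgue_on; apply: aeW => s sD.
exact: kstar_fun_formula.
Qed.

End Bounds.

End VolterraKernel.

Theorem theorem3p1 (R : realType) (T : R) (hT : 0 < T)
  (d : measure_display) (Omega : measurableType d) (P : probability Omega R)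
  (W X : R -> {RV P >-> R}) (K : R -> R -> R) (Kstar : (R -> R) -> R -> R)
  (hW : brownian_motion T W)
  (hX : forall t, t \in `[0, T] -> is_wiener_integral T W (K t) (X t))
  (hadapted : adapted T W X)
  (hK : forall t s, t \in `[0, T] -> s \in `[0, T] -> t < s -> K t s = 0)
  (hKstar : kernel_operator T K Kstar) :
  (* (a) *)
  (forall (N : nat) (p a : nat -> R), subdivision T N p ->
   forall s, s \in `]p 0%N, T] ->
   Kstar (step_fun N p a) s =
   \sum_(i < N) (chi (p i.+1) s - chi (p i) s) *
     (a i * K (p i.+1) s +
      \sum_(i.+1 <= k < N) a k * (K (p k.+1) s - K (p k) s))) /\
  (* (b) *)
  ((forall s, s \in `[0, T] -> bounded_variation 0 T (K^~ s)) ->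
   (forall s, s \in `]0, T[ -> cvg (K t s @[t --> s^'+])) ->
   forall f : R -> R, {within `[0, T], continuous f} ->
   forall s, s \in `]0, T[ ->
   tagged_limit T Kstar f s
     (diag_right K s * f s + stieltjes_integral s T (K^~ s) f) /\
   Kstar f s = diag_right K s * f s + stieltjes_integral s T (K^~ s) f) /\
  (* (c) *)
  (forall K0 K1 : R, 0 <= K1 ->
   {within [set z : R * R | 0 <= z.2 /\ z.2 <= z.1 /\ z.1 <= T],
     continuous (fun z => K z.1 z.2)} ->
   (forall t s, 0 <= s -> s <= t -> t <= T -> 0 <= K t s) ->
   (forall t, t \in `]0, T[ -> K t t <= K0) ->
   (forall s, s \in `[0, T] ->
      {in `[0, T] &, nondecreasing_fun (K^~ s)} \/
      {in `[0, T] &, nonincreasing_fun (K^~ s)}) ->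
   (forall t s, 0 < s -> s < t -> t < T -> derivable (K^~ s) t 1) ->
   (forall t, t \in `]0, T[ ->
      (\int[lebesgue_measure]_(s in `]0%R, t[)
         (K T s * `|derive1 (K^~ s) t|)%:E <= (K1 ^+ 2)%:E)%E) ->
   exists A : L2 T -> L2 T,
     [/\ L2_bounded A,
         L2_extends (kstar_formula T K) A &
         ((L2_opnorm A) ^+ 2 <= ((K0 + K1) ^+ 2)%:E)%E]).
Proof.
split; [|split].
- by move=> N p a sp s sT; exact: (kernel_operator_step_above hKstar hK).
- move=> Kbv Kcv f cf s sD; move: (sD); rewrite in_itv/= => /andP[s0 sT].
  have sin : s \in `[0, T] by rewrite in_itv/= !ltW.
  have K0 t : 0 <= t -> t < s -> K t s = 0.
    by move=> t0 ts; apply: hK => //; rewrite in_itv/= t0 ltW// (lt_trans ts).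
  have lim := rs_limit_bounded_variation s0 sT cf (Kbv s sin) K0.
  suff tl : tagged_limit T Kstar f s
      (diag_right K s * f s + stieltjes_integral s T (K^~ s) f).
    by split=> //; apply: (kernel_operator_limit hKstar).
  move=> e /lim[delta d0 dP]; exists delta => // N p tau sp p0 pT mesh tags.
  by rewrite (kernel_operator_step hKstar)//; exact: dP.
- move=> K0 K1 K10 Kc Kge0 Kdiag Kmono Kder Kschur.
  exists (kstar_L2 hT hK Kc Kge0 Kmono Kder Kdiag K10 Kschur); split.
  + split; first exact: kstar_L2_operator.
    by apply: (le_lt_trans (kstar_L2_opnorm_le _ _ _ _ _ _ _ _ _)); exact: ltry.
  + exact: kstar_L2_extends.
  + exact: kstar_L2_opnorm_sqr_le.
Qed.
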